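(* Let $h=\pi^2/(6\log 2)$ and let $B>0$ be a constant such that the sequence $Z_n(x)=\dfrac{\log q_n(x)-\frac h2 n}{B\sqrt n}$ is asymptotically Gaussian. If $x$ is an irrational number in $(0,1)$, then $$\frac{\log L_n(x,\mathcal{CF},\mathcal F)}{n}=\frac{\pi^2}{12\log 2}+\frac{B}{\sqrt n}Z_n(x)+O\left(\frac1n\right)\quad\text{as }n\to\infty,$$ with $Z_n$ asymptotically Gaussian. In particular, $$\lim_{n\to\infty}\frac{\log L_n(x,\mathcal{CF},\mathcal F)}{n}=\frac{\pi^2}{12\log 2}\quad\text{for Lebesgue-a.e. }x.$$
   Context: $\mathbb N$ includes $0$; $|\cdot|$ is Lebesgue measure; $\log$ is the natural logarithm. For an irrational $x\in(0,1)$ with continued fraction expansion $x=[0;a_1,a_2,\dots]$, set $p_{-1}=1,p_0=0,q_{-1}=0,q_0=1$, $p_n=a_np_{n-1}+p_{n-2}$, $q_n=q_n(x)=a_nq_{n-1}+q_{n-2}$. ''$Z_n$ is asymptotically Gaussian'' means: for every $t\in\mathbb R$, $|\{x\in[0,1]:Z_n(x)<t\}|=\frac1{\sqrt{2\pi}}\int_{-\infty}^t e^{-w^2/2}\,dw+O(1/\sqrt n)$ as $n\to\infty$. The existence of a constant $B>0$ with this property is a known theorem. $\mathcal{CF}$ is the sequence of partitions of $[0,1]$ into open intervals whose depth-$0$ partition is $\{(0,1)\}$ and whose depth-$n$ interval containing the irrational $x$ ($n\ge1$) is the open interval $I_n^{\mathcal{CF}}(x)$ with endpoints $\frac{p_n}{q_n}$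 and $\frac{p_n+p_{n-1}}{q_n+q_{n-1}}$. $\mathcal F=\{F_n\}_{n\in\mathbb N}$ is the Farey sequence of partitions: $F_n$ consists of the open intervals between consecutive elements of $\{p/q:0\le p\le q\le n+1,\ q\ge1,\ \gcd(p,q)=1\}$, and $I_n^{\mathcal F}(x)$ is the interval of $F_n$ containing $x$. The Lochs index is $L_n(x,\mathcal{CF},\mathcal F)=\sup\{\ell\in\mathbb N: I_n^{\mathcal{CF}}(x)\subseteq I_\ell^{\mathcal F}(x)\}$. *)

(* Defs.v *)
From HB Require Import structures.
From mathcomp Require Import all_boot all_order all_algebra.
From mathcomp Require Import all_classical all_reals all_analysis.
Set Implicit Arguments.
Unset Strict Implicit.
Unset Printing Implicit Defensive.
Import Order.TTheory GRing.Theory Num.Theory.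
Import numFieldNormedType.Exports.
Local Open Scope classical_set_scope.
Local Open Scope ring_scope.

Definition gauss_map (R : realType) (x : R) : R :=
  x^-1 - (Num.truncn x^-1)%:R.

(* The partial quotient a_n, for 1 <= n; the value at n = 0 is irrelevant. *)
Definition cf_digit (R : realType) (x : R) (n : nat) : nat :=
  Num.truncn (iter n.-1 (@gauss_map R) x)^-1.

(* The indices are shifted by one: with u_(-1) = u and u_0 = v, and
   u_n = a_n u_(n-1) + u_(n-2) for 1 <= n, this is u_(n-1). *)
Fixpoint cf_rec (a : nat -> nat) (u v n : nat) : nat :=
  match n with
  | 0 => u
  | 1 => v
  | (k.+1 as m).+1 => (a m * cf_rec a u v m + cf_rec a u v k)%N
  end.

Definition cf_p (R : realType) (x : R) (n : nat) : nat :=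
  cf_rec (cf_digit x) 1 0 n.+1.

Definition cf_q (R : realType) (x : R) (n : nat) : nat :=
  cf_rec (cf_digit x) 0 1 n.+1.

(* p_(n-1) and q_(n-1), including n = 0 *)
Definition cf_p_prev (R : realType) (x : R) (n : nat) : nat :=
  cf_rec (cf_digit x) 1 0 n.

Definition cf_q_prev (R : realType) (x : R) (n : nat) : nat :=
  cf_rec (cf_digit x) 0 1 n.

Definition cf_interval (R : realType) (n : nat) (x : R) : set R :=
  let a := (cf_p x n)%:R / (cf_q x n)%:R in
  let b := (cf_p x n + cf_p_prev x n)%:R / (cf_q x n + cf_q_prev x n)%:R in
  `]Num.min a b, Num.max a b[%classic.

(* A sequence of partitions is given by its intervals at each depth. *)
Definition partition_seq (R : realType) := nat -> set (set R).

(* The partitions cover (0,1) only up to a countable set: for a point x lying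
   in no interval of depth n, the cell is empty. *)
Definition cell (R : realType) (P : partition_seq R) (n : nat) (x : R) : set R :=
  \bigcup_(J in [set J | P n J /\ J x]) J.

Definition CF (R : realType) : partition_seq R := fun n =>
  if n is 0 then [set `]0, 1[%classic]
  else [set cf_interval n x | x in `]0, 1[%classic `&` @irrational R].

Definition farey_fraction (R : realType) (n : nat) : set R :=
  [set r | exists p q : nat,
     [/\ (p <= q)%N, (q <= n.+1)%N, (1 <= q)%N, coprime p q & r = p%:R / q%:R]].

Definition Farey (R : realType) : partition_seq R := fun n =>
  [set J | exists a b : R,
     [/\ farey_fraction n a, farey_fraction n b, a < b,
         (forall c, farey_fraction n c -> ~ (a < c < b)) &
         J = `]a, b[%classic]].

(* For x irrational in (0,1) and the sequences CF and Farey, the set of indices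
   contains 0 and is bounded, so the real-valued [sup] is its maximum. *)
Definition lochs_index (R : realType) (n : nat) (x : R)
    (P Q : partition_seq R) : R :=
  sup [set l%:R | l in [set l : nat | cell P n x `<=` cell Q l x]].

(* Z n x is only meaningful at irrational x, hence the restriction to
   irrational points; it discards a null set. *)
Definition asymptotically_gaussian (R : realType) (Z : nat -> R -> R) : Prop :=
  forall t : R,
    (fun n : nat => fine (lebesgue_measure
       [set x : R | [/\ x \in `[0, 1], irrational x & Z n x < t]]))
    = (fun _ : nat => (Num.sqrt (2 * pi))^-1 *
         \int[lebesgue_measure]_(w in `]-oo, t]) expR (- (w ^+ 2 / 2)))
    +O_\oo (fun n : nat => (Num.sqrt (n%:R : R))^-1).

(* Main.v *)
(** Since $I_n^{CF}(x)$ is an interval between two fractions of determinant one, the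
    fraction of least denominator inside it is the mediant of its endpoints. It
    therefore lies in one Farey interval of depth $l$ exactly when
    $l + 1 < 2 q_n + q_{n-1}$, so that $q_n \le L_n \le 3 q_n$ and
    $\log L_n = \log q_n + O(1)$.

    For the almost everywhere limit, the constants in the Gaussian estimate depend on
    $t$, so the hypothesis only gives convergence in probability of $\log q_n / n$. It
    is upgraded by a Chernoff bound. Concatenating words of partial quotients
    multiplies denominators up to a factor 2 and cylinder lengths up to a factor 4.
    Hence, for fixed $n$, the exponential moments of $\log q_{kn}$ grow at most
    geometrically in $k$. Their ratio is estimated by convergence in probability
    together with the uniform integrability bound $\int \sqrt{q_n} \le 3^n$.
    Borel-Cantelli along the multiples of a large $n$, and the monotonicity of $q_n$
    in between, conclude. *)

Require Import Defs.
From HB Require Import structures.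
From mathcomp Require Import all_boot all_order all_algebra.
From mathcomp Require Import all_classical all_reals all_analysis.
From mathcomp Require Import zify ring lra.
Import Order.TTheory GRing.Theory Num.Theory.
Import numFieldNormedType.Exports.
Local Open Scope classical_set_scope.
Local Open Scope ring_scope.

Set Implicit Arguments.
Unset Strict Implicit.

(** * Continuants and the Gauss map *)

Lemma eq_cf_rec (a b : nat -> nat) (u v n : nat) :
  (forall i, (0 < i < n)%N -> a i = b i) -> cf_rec a u v n = cf_rec b u v n.
Proof.
suff H : forall k, (k <= n)%N -> (forall i, (0 < i < n)%N -> a i = b i) ->
    cf_rec a u v k = cf_rec b u v k by exact: H.
elim/ltn_ind => -[|[|k]] // IH kn ab.
by rewrite /= -/(cf_rec _ _ _ k.+1) (IH k.+1) ?(IH k) ?ab //; lia.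
Qed.

Lemma cf_recSS (a : nat -> nat) (u v n : nat) :
  cf_rec a u v n.+2 = (a n.+1 * cf_rec a u v n.+1 + cf_rec a u v n)%N.
Proof. by []. Qed.

Lemma cf_rec_linear (a : nat -> nat) (u v n : nat) :
  cf_rec a u v n = (u * cf_rec a 1 0 n + v * cf_rec a 0 1 n)%N.
Proof.
elim/ltn_ind: n => -[|[|n]] IH; [by rewrite /=; lia| by rewrite /=; lia|].
by rewrite !cf_recSS (IH n.+1) ?(IH n) //; lia.
Qed.

(** The recurrence looks back two steps, so it can be restarted from any two consecutive values with
    shifted digits. *)
Lemma cf_rec_shift (a : nat -> nat) (u v m n : nat) :
  cf_rec a u v (m + n) =
  cf_rec (fun i => a (i + m)%N) (cf_rec a u v m) (cf_rec a u v m.+1) n.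
Proof.
elim/ltn_ind: n => -[|[|n]] IH; [by rewrite addn0|by rewrite addn1|].
rewrite cf_recSS -(IH n.+1) // -(IH n) //.
by rewrite !addnS cf_recSS addSn (addnC n m).
Qed.

(** This is $[0;a_1,a_2,\dots] = 1/(a_1+[0;a_2,\dots])$ at the level of convergents: the denominator
    of the tail becomes the numerator. *)
Lemma cf_rec_shift1 (a : nat -> nat) (n : nat) :
  cf_rec a 1 0 n.+1 = cf_rec (fun i => a i.+1) 0 1 n /\
  cf_rec a 0 1 n.+1 = (cf_rec (fun i => a i.+1) 1 0 n
                       + a 1%N * cf_rec (fun i => a i.+1) 0 1 n)%N.
Proof.
rewrite -(add1n n) !cf_rec_shift /= !(muln1, muln0, addn0, add0n).
have -> : (fun i => a (i + 1)%N) = (fun i => a i.+1) by apply/funext => i; rewrite addn1.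
by split=> //; rewrite [LHS]cf_rec_linear mul1n.
Qed.

Lemma cf_recQ_gt0 (a : nat -> nat) (n : nat) :
  (forall i, (0 < i <= n)%N -> (0 < a i)%N) -> (0 < cf_rec a 0 1 n.+1)%N.
Proof.
elim: n => [//|n IH] a_gt0; rewrite cf_recSS addn_gt0 muln_gt0.
by rewrite a_gt0 ?IH //; [move=> i Hi; apply: a_gt0|]; lia.
Qed.

Lemma cf_recQ_leS (a : nat -> nat) (n : nat) :
  (forall i, (0 < i <= n)%N -> (0 < a i)%N) ->
  (cf_rec a 0 1 n <= cf_rec a 0 1 n.+1)%N.
Proof.
case: n => [//|n] a_gt0; rewrite cf_recSS.
have : (0 < a n.+1)%N by apply: a_gt0; lia.
by nia.
Qed.

Lemma cf_rec_PleQ (a : nat -> nat) (n : nat) :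
  (forall i, (0 < i <= n)%N -> (0 < a i)%N) ->
  (cf_rec a 1 0 n.+1 <= cf_rec a 0 1 n.+1)%N.
Proof.
move=> a_gt0; have [-> ->] := cf_rec_shift1 a n; case: n a_gt0 => [//|n] a_gt0.
have : (0 < a 1)%N by apply: a_gt0.
by nia.
Qed.

(* The determinant $p_{n-1} q_n - p_n q_{n-1} = (-1)^n$, with the sign moved so that
   no subtraction occurs. *)
Lemma cf_rec_det (a : nat -> nat) (n : nat) :
  (cf_rec a 1 0 n * cf_rec a 0 1 n.+1 + odd n =
   cf_rec a 1 0 n.+1 * cf_rec a 0 1 n + ~~ odd n)%N.
Proof.
elim: n => [//|n IH]; rewrite !cf_recSS /=.
by move: IH; case: (odd n) => /=; nia.
Qed.

(** With primes for the shifted digits, $q_{m+n} = q_m q'_n + q_{m-1} p'_n$, and the second term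
    lies between 0 and the first because $q_{m-1} \le q_m$ and $p'_n \le q'_n$. *)
Lemma cf_recQ_mul (a : nat -> nat) (m n : nat) :
  (forall i, (0 < i <= m + n)%N -> (0 < a i)%N) ->
  (cf_rec a 0 1 m.+1 * cf_rec (fun i => a (i + m)%N) 0 1 n.+1
     <= cf_rec a 0 1 (m + n).+1
     <= 2 * (cf_rec a 0 1 m.+1 * cf_rec (fun i => a (i + m)%N) 0 1 n.+1))%N.
Proof.
move=> a_gt0; rewrite -addnS cf_rec_shift (cf_rec_linear _ (cf_rec _ _ _ _)).
have H1 : (cf_rec a 0 1 m <= cf_rec a 0 1 m.+1)%N.
  by apply: cf_recQ_leS => i Hi; apply: a_gt0; lia.
have H2 : (cf_rec (fun i => a (i + m)%N) 1 0 n.+1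
    <= cf_rec (fun i => a (i + m)%N) 0 1 n.+1)%N.
  by apply: cf_rec_PleQ => i Hi; apply: a_gt0; lia.
by have := leq_mul H1 H2; lia.
Qed.

Lemma pos_digitsS (a : nat -> nat) n :
  (forall i, (0 < i <= n.+1)%N -> (0 < a i)%N) ->
  forall i, (0 < i <= n)%N -> (0 < a i.+1)%N.
Proof. by move=> a_gt0 i /andP[_ ?]; apply: a_gt0. Qed.

Section gauss_map.
Context {R : realType}.
Implicit Types (a : nat -> nat) (x t z : R) (n : nat).

Lemma irrational_gt0 x : 0 <= x -> irrational x -> 0 < x.
Proof.
move=> x0 xirr; rewrite lt_neqAle x0 andbT; apply/eqP => x0'.
by apply: xirr; exists 0 => //; rewrite -x0' rmorph0.
Qed.

(** Irrationality excludes the value 0, so the Gauss map can be iterated indefinitely inside the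
    open interval. *)
Lemma gauss_map_itv x : x \in `]0, 1[ -> irrational x ->
  (gauss_map x \in `]0, 1[) /\ irrational (gauss_map x).
Proof.
rewrite in_itv/= => /andP[x0 x1] xirr.
have girr : irrational (gauss_map x).
  move=> [r _ rE]; apply: xirr; exists (r + (Num.truncn x^-1)%:R)^-1 => //.
  by rewrite fmorphV rmorphD rmorph_nat /= rE /gauss_map subrK invrK.
split=> //; have xV : 0 <= x^-1 by rewrite invr_ge0 ltW.
have /andP[H1 H2] := truncn_itv xV.
rewrite in_itv/= irrational_gt0 //= /gauss_map ?subr_ge0 //.
by rewrite ltrBlDr addrC natr1.
Qed.

Lemma iter_gauss_map_itv x n : x \in `]0, 1[ -> irrational x ->
  (iter n (@gauss_map R) x \in `]0, 1[) /\ irrational (iter n (@gauss_map R) x).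
Proof.
move=> x01 xirr; elim: n => [//|n [IH1 IH2]] /=.
exact: gauss_map_itv.
Qed.

Lemma cf_digit_gt0 x n : x \in `]0, 1[ -> irrational x -> (0 < cf_digit x n)%N.
Proof.
move=> x01 xirr; have [] := iter_gauss_map_itv n.-1 x01 xirr.
rewrite in_itv/= /cf_digit => /andP[H0 H1] _.
by rewrite truncn_gt0 invf_ge1 // ltW.
Qed.

Lemma cf_digit_gauss_map x i : (0 < i)%N -> cf_digit x i.+1 = cf_digit (gauss_map x) i.
Proof. by case: i => // i _; rewrite /cf_digit /= -iterSr. Qed.

Lemma gauss_map_inv x : x \in `]0, 1[ ->
  x = ((cf_digit x 1)%:R + gauss_map x)^-1.
Proof. by move=> x01; rewrite /cf_digit /gauss_map /= addrC subrK invrK. Qed.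

(** The inverse branch $t \mapsto [0;a_1,\dots,a_n+t]$ of the $n$-th iterate of the Gauss map; it is
    the identity for $n=0$. *)
Definition cf_mobius a n t : R :=
  ((cf_rec a 1 0 n.+1)%:R + t * (cf_rec a 1 0 n)%:R) /
  ((cf_rec a 0 1 n.+1)%:R + t * (cf_rec a 0 1 n)%:R).

Lemma cf_mobius0 a t : cf_mobius a 0 t = t.
Proof. by rewrite /cf_mobius /= mulr1 mulr0 addr0 add0r divr1. Qed.

Lemma cf_mobius_den_gt0 a n t : (forall i, (0 < i <= n)%N -> (0 < a i)%N) ->
  0 <= t -> 0 < (cf_rec a 0 1 n.+1)%:R + t * (cf_rec a 0 1 n)%:R.
Proof.
move=> a_gt0 t0; apply: ltr_wpDr; first exact: mulr_ge0.
by rewrite ltr0n cf_recQ_gt0.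
Qed.

Lemma cf_mobiusS a n t : (forall i, (0 < i <= n.+1)%N -> (0 < a i)%N) -> 0 <= t ->
  cf_mobius a n.+1 t = ((a 1%N)%:R + cf_mobius (fun i => a i.+1) n t)^-1.
Proof.
move=> a_gt0 t0; rewrite /cf_mobius.
have [-> ->] := cf_rec_shift1 a n; have [-> ->] := cf_rec_shift1 a n.+1.
have := @cf_mobius_den_gt0 (fun i => a i.+1) n t _ t0.
move=> /(_ (pos_digitsS a_gt0)).
set D := (_ + _) => D0; rewrite -[(a 1%N)%:R](mulfK (lt0r_neq0 D0)) -mulrDl invf_div.
congr (_ / _).
by rewrite /D !natrD !natrM; ring.
Qed.

Lemma cf_mobius_itv a n t : (forall i, (0 < i <= n)%N -> (0 < a i)%N) ->
  t \in `]0, 1[ -> cf_mobius a n t \in `]0, 1[.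
Proof.
elim: n a => [|n IH] a a_gt0 t01; first by rewrite cf_mobius0.
have t0 : 0 <= t by move: t01; rewrite in_itv/= => /andP[/ltW].
rewrite cf_mobiusS //.
have := IH (fun i => a i.+1) (pos_digitsS a_gt0) t01.
rewrite !in_itv/= => /andP[H0 H1].
have : 1 <= (a 1%N)%:R :> R by rewrite ler1n a_gt0.
move=> ha; rewrite invr_gt0 invf_lt1; lra.
Qed.

Lemma cf_mobius_digit a n t : (forall i, (0 < i <= n)%N -> (0 < a i)%N) ->
  t \in `]0, 1[ -> forall i, (0 < i <= n)%N -> cf_digit (cf_mobius a n t) i = a i.
Proof.
elim: n a => [|n IH] a a_gt0 t01 i Hi; first by lia.
have t0 : 0 <= t by move: t01; rewrite in_itv/= => /andP[/ltW].
have b_gt0 := pos_digitsS a_gt0.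
have := cf_mobius_itv b_gt0 t01; rewrite in_itv/= => /andP[H0 H1].
have trE : Num.truncn (cf_mobius a n.+1 t)^-1 = a 1%N.
  rewrite cf_mobiusS // invrK; apply: truncn_def.
  by rewrite -natr1; lra.
case: i Hi => // -[_|i Hi]; first exact: trE.
rewrite cf_digit_gauss_map // /gauss_map trE cf_mobiusS // invrK addrAC subrr add0r.
exact: (IH _ b_gt0 t01).
Qed.

Lemma cf_mobius_iter x n : x \in `]0, 1[ -> irrational x ->
  x = cf_mobius (cf_digit x) n (iter n (@gauss_map R) x).
Proof.
elim: n x => [|n IH] x x01 xirr; first by rewrite cf_mobius0.
have [g01 girr] := gauss_map_itv x01 xirr.
have [t01 _] := iter_gauss_map_itv n.+1 x01 xirr.
rewrite cf_mobiusS; last 2 first.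
- by move=> i _; apply: cf_digit_gt0.
- by move: t01; rewrite in_itv/= => /andP[/ltW].
rewrite {1}(gauss_map_inv x01) {1}(IH _ g01 girr) iterSr; congr (_ + _)^-1.
rewrite /cf_mobius; congr ((_%:R + _ * _%:R) / (_%:R + _ * _%:R));
  by apply: eq_cf_rec => -[|i]//= _; rewrite [RHS]cf_digit_gauss_map.
Qed.

End gauss_map.

Arguments cf_rec : simpl never.

(** * The Lochs index *)

Section lochs_index.
Context {R : realType}.
Implicit Types (a : nat -> nat) (x t z : R) (n : nat).

Lemma ltr_nat_frac (p q c d : nat) : (0 < q)%N -> (0 < d)%N ->
  (p%:R / q%:R < c%:R / d%:R :> R) = (p * d < c * q)%N.
Proof.
move=> q0 d0; rewrite ltr_pdivrMr ?ltr0n // mulrAC ltr_pdivlMr ?ltr0n //.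
by rewrite -!natrM ltr_nat.
Qed.

(** Passing to the mediant keeps the determinant $\pm 1$. The two cases are the two parities of $n$,
    that is, the two orders of the endpoints. *)
Lemma cf_rec_det_mediant a n :
  let p := cf_rec a 1 0 n.+1 in let q := cf_rec a 0 1 n.+1 in
  let r := (p + cf_rec a 1 0 n)%N in let s := (q + cf_rec a 0 1 n)%N in
  (p * s).+1 = (r * q)%N \/ (r * q).+1 = (p * s)%N.
Proof.
move=> p q r s; rewrite /r /s; have := cf_rec_det a n; rewrite -/p -/q.
by case: (odd n) => /= ?; [right|left]; lia.
Qed.

(** The inverse branch is monotone in $t$ and takes the value $A$ at $t=0$ and $C$ at $t=1$. *)
Lemma cf_itv_mobius a n z : (forall i, (0 < i <= n)%N -> (0 < a i)%N) ->
  let A : R := (cf_rec a 1 0 n.+1)%:R / (cf_rec a 0 1 n.+1)%:R in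
  let C : R := (cf_rec a 1 0 n.+1 + cf_rec a 1 0 n)%:R /
               (cf_rec a 0 1 n.+1 + cf_rec a 0 1 n)%:R in
  (z \in `]Num.min A C, Num.max A C[) <->
  exists2 t, (t \in `]0, 1[) & z = cf_mobius a n t.
Proof.
move=> a_gt0 A C; have Q0 := cf_recQ_gt0 a_gt0.
have neAC : A != C.
  have := cf_rec_det_mediant a n => /= H.
  apply/eqP => neAC; have : ~~ (A < C) /\ ~~ (C < A) by rewrite neAC ltxx.
  rewrite /A /C !ltr_nat_frac ?addn_gt0 ?Q0 // -!leqNgt.
by case=> *; case: H; lia.
(* The branch is $A + s(C-A)$ with $s = t(q+q')/(q+tq')$, which runs from 0 to 1 with $t$ whichever
   endpoint is the larger. *)
have mobiusE t : 0 <= t -> cf_mobius a n t =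
    A + (t * ((cf_rec a 0 1 n.+1)%:R + (cf_rec a 0 1 n)%:R) /
    ((cf_rec a 0 1 n.+1)%:R + t * (cf_rec a 0 1 n)%:R)) * (C - A).
  move=> t0; have D0 := cf_mobius_den_gt0 a_gt0 t0.
  have D1 := cf_mobius_den_gt0 a_gt0 (@ler01 R).
  rewrite /A /C /cf_mobius !natrD; move: D1 D0; rewrite mul1r.
  move: Q0; rewrite -(ltr0n R).
  move: (_%:R) (_%:R) (_%:R) (_%:R) => q q' p p' D0 D1 D2.
  by field; rewrite !gt_eqF.
move: Q0; rewrite -(ltr0n R); move: mobiusE.
have : 0 <= (cf_rec a 0 1 n)%:R :> R by [].
move: (cf_rec a 0 1 n)%:R (cf_rec a 0 1 n.+1)%:R => q' q q'0 mobiusE q0.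
split.
- rewrite in_itv/= => zAC.
  have CA0 : C - A != 0 by rewrite subr_eq0 eq_sym.
  set s := (z - A) / (C - A).
  have zE : z = A + s * (C - A) by rewrite /s divfK // addrC subrK.
  have /andP[s0 s1] : 0 < s < 1.
    move: zAC; rewrite /s; case: (ltgtP A C) neAC => // ltAC _ /andP[zA zC].
      by rewrite divr_gt0 ?ltr_pdivrMr ?subr_gt0 //=; lra.
    by rewrite -mulrNN -invrN !opprB divr_gt0 ?ltr_pdivrMr ?subr_gt0 //=; lra.
  have D0 : 0 < q + q' - s * q' by nra.
  have t0 : 0 < s * q / (q + q' - s * q') by rewrite divr_gt0 // mulr_gt0.
  (* The witness solves $s = t(q+q')/(q+tq')$ for $t$. *)
  exists (s * q / (q + q' - s * q')).
    by rewrite in_itv/= t0 ltr_pdivrMr //; nra.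
  rewrite mobiusE 1?ltW // [LHS]zE; congr (_ + _ * _).
  field; rewrite !gt_eqF //.
  have -> : q * (q + q' - s * q') + s * q * q' = q * (q + q') by ring.
  by rewrite mulr_gt0 //; lra.
- move=> [t]; rewrite in_itv/= => /andP[t0 t1] ->; rewrite mobiusE 1?ltW //.
  have D0 : 0 < q + t * q' by nra.
  set s := t * _ / _; have s0 : 0 < s by rewrite divr_gt0 // mulr_gt0 //; lra.
  have s1 : s < 1 by rewrite ltr_pdivrMr //; nra.
  by rewrite in_itv/=; case: (ltgtP A C) neAC => // ltAC _; nra.
Qed.

Lemma cf_interval_digit x y n : y \in `]0, 1[ -> irrational y ->
  cf_interval n y x -> forall i, (0 < i <= n)%N -> cf_digit x i = cf_digit y i.
Proof.
move=> y01 yirr yx i Hi.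
have a_gt0 : forall i, (0 < i <= n)%N -> (0 < cf_digit y i)%N.
  by move=> j _; apply: cf_digit_gt0.
have [t t01 ->] := (cf_itv_mobius x a_gt0).1 yx.
exact: cf_mobius_digit.
Qed.

Lemma cf_interval_refl x n : x \in `]0, 1[ -> irrational x -> cf_interval n x x.
Proof.
move=> x01 xirr; have [t01 _] := iter_gauss_map_itv n x01 xirr.
apply/cf_itv_mobius; first by move=> i _; apply: cf_digit_gt0.
by eexists; [exact: t01|exact: cf_mobius_iter].
Qed.

Lemma cf_interval_eq x y n :
  (forall i, (0 < i <= n)%N -> cf_digit x i = cf_digit y i) ->
  cf_interval n x = cf_interval n y.
Proof.
move=> xy; rewrite /cf_interval /cf_p /cf_q /cf_p_prev /cf_q_prev.
have H u v : cf_rec (cf_digit x) u v n.+1 = cf_rec (cf_digit y) u v n.+1.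
  by apply: eq_cf_rec => i Hi; apply: xy; lia.
have H' u v : cf_rec (cf_digit x) u v n = cf_rec (cf_digit y) u v n.
  by apply: eq_cf_rec => i Hi; apply: xy; lia.
by rewrite !H !H'.
Qed.

(** Every interval of depth $n$ through $x$ belongs to a point with the same first $n$ digits as
    $x$, and the interval depends on these digits only. *)
Lemma cell_CF x n : (0 < n)%N -> x \in `]0, 1[ -> irrational x ->
  cell (@CF R) n x = cf_interval n x.
Proof.
case: n => // n _ x01 xirr; apply/seteqP; split.
- move=> z [J [[y [y01 yirr] <-] yx]]; rewrite -(@cf_interval_eq x y) //.
  by apply: cf_interval_digit => //; rewrite inE.
- move=> z zx; exists (cf_interval n.+1 x) => //; split; last exact: cf_interval_refl.
  by exists x => //; split => //; move: x01; rewrite in_itv.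
Qed.

Lemma irrational_neq_frac x (p q : nat) : irrational x -> x != p%:R / q%:R.
Proof.
move=> xirr; apply/eqP => xE; apply: xirr; exists (p%:R / q%:R) => //.
by rewrite xE rmorphM /= fmorphV !rmorph_nat.
Qed.

(** There are finitely many Farey fractions of depth [l] and none equals $x$, so the largest one
    below $x$ and the smallest one above it exist and are consecutive. *)
Lemma farey_itv_exists x l : x \in `]0, 1[ -> irrational x ->
  exists a b : R, [/\ farey_fraction l a, farey_fraction l b, a < x < b &
    forall c, farey_fraction l c -> ~ (a < c < b)].
Proof.
rewrite in_itv/= => /andP[x0 x1] xirr.
(* Since $p \le q \le l+1$, pairs of ordinals below $l+2$ index all the fractions, and [N] selects
   the reduced ones. *)
pose F (i : 'I_l.+2 * 'I_l.+2) : R := (i.1 : nat)%:R / (i.2 : nat)%:R.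
pose N (i : 'I_l.+2 * 'I_l.+2) := [&& (i.1 <= i.2)%N, (0 < i.2)%N & coprime i.1 i.2].
have FN i : N i -> farey_fraction l (F i).
  by move=> /and3P[? ? ?]; exists i.1, i.2; split => //; case: i.2.
have NF c : farey_fraction l c -> exists2 i, N i & c = F i.
  move=> [p [q [pq ql q0 copq ->]]].
  have pl : (p < l.+2)%N by lia.
  by exists (Ordinal pl, Ordinal (ql : (q < l.+2)%N)) => //; apply/and3P.
pose i0 : 'I_l.+2 * 'I_l.+2 := (ord0, @Ordinal l.+2 1 isT).
pose i1 : 'I_l.+2 * 'I_l.+2 := (@Ordinal l.+2 1 isT, @Ordinal l.+2 1 isT).
have i0P : N i0 && (F i0 < x) by rewrite /N /F /= mul0r.
have i1P : N i1 && (x < F i1) by rewrite /N /F /= divr1.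
pose i := [arg max_(i > i0 | N i && (F i < x)) F i]%O.
pose j := [arg min_(i < i1 | N i && (x < F i)) F i]%O.
have [/andP[Ni iltx] imax] : N i && (F i < x) /\
    forall k, N k && (F k < x) -> F k <= F i.
  by rewrite /i; case: arg_maxP => //= ? H1 H2; split => //.
have [/andP[Nj xltj] jmin] : N j && (x < F j) /\
    forall k, N k && (x < F k) -> F j <= F k.
  by rewrite /j; case: arg_minP => //= ? H1 H2; split => //.
exists (F i), (F j); split; [exact: FN|exact: FN|by rewrite iltx|].
move=> c /NF[k Nk ->] /andP[ik kj].
have [kx|xk|xE] := ltgtP (F k) x.
- by have := imax k; rewrite Nk kx leNgt ik => /(_ isT).
- by have := jmin k; rewrite Nk xk leNgt kj => /(_ isT).
- by have := irrational_neq_frac k.1 k.2 xirr; rewrite -xE eqxx.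
Qed.

(* $d = q (r d - c s) + s (c q - p d)$, where both differences are positive. *)
Lemma frac_between_den (p q r s c d : nat) : (r * q)%N = (p * s).+1 ->
  (p * d < c * q)%N -> (c * s < r * d)%N -> (q + s <= d)%N.
Proof.
move=> det H1 H2.
have E : (d + q * (c * s) + s * (p * d) = q * (r * d) + s * (c * q))%N.
  have : (d * (r * q) = d * (p * s).+1)%N by rewrite det.
  by lia.
have : (q * (c * s).+1 <= q * (r * d))%N by rewrite leq_mul2l H2 orbT.
have : (s * (p * d).+1 <= s * (c * q))%N by rewrite leq_mul2l H1 orbT.
by lia.
Qed.

Lemma cf_q_prev_le x n : x \in `]0, 1[ -> irrational x -> (cf_q_prev x n <= cf_q x n)%N.
Proof. by move=> x01 xirr; apply: cf_recQ_leS => i _; apply: cf_digit_gt0. Qed.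

Lemma cf_q_gt0 x n : x \in `]0, 1[ -> irrational x -> (0 < cf_q x n)%N.
Proof. by move=> x01 xirr; apply: cf_recQ_gt0 => i _; apply: cf_digit_gt0. Qed.

Lemma cf_interval_sub_farey x n l : (0 < n)%N -> x \in `]0, 1[ -> irrational x ->
  cell (@CF R) n x `<=` cell (@Farey R) l x <->
  (l.+1 < 2 * cf_q x n + cf_q_prev x n)%N.
Proof.
move=> n0 x01 xirr; rewrite cell_CF //.
have a_gt0 : forall m i, (0 < i <= m)%N -> (0 < cf_digit x i)%N.
  by move=> m i _; apply: cf_digit_gt0.
have xI := cf_interval_refl n x01 xirr; move: xI.
have := cf_rec_det_mediant (cf_digit x) n.
have q0 := cf_recQ_gt0 (a_gt0 n).
have pq := cf_rec_PleQ (a_gt0 n).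
have pq' : (cf_rec (cf_digit x) 1 0 n <= cf_rec (cf_digit x) 0 1 n)%N.
  by case: n n0 {q0 pq} => // n _; apply: cf_rec_PleQ (a_gt0 n).
move: q0 pq pq'; rewrite /cf_interval /cf_p /cf_q /cf_p_prev /cf_q_prev /=.
move: (cf_rec _ _ _ _) (cf_rec _ _ _ _) (cf_rec _ _ _ _) (cf_rec _ _ _ _).
move=> q' p' p q q0 pq pq' det; rewrite in_itv/=; set A := _ / _; set C := _ / _.
move=> /andP[xmin xmax].
have s0 : (0 < q + q')%N by rewrite addn_gt0 q0.
split.
- have [//|lbig] := ltnP l.+1; move=> sub; exfalso.
  have q20 : (0 < 2 * q + q')%N by lia.
  (* For $l+1 \ge 2q_n+q_{n-1}$ the mediant of the endpoints is a Farey fraction of depth [l]; the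
     inclusion would put it inside a Farey interval. *)
  have m_farey : farey_fraction l ((2 * p + p')%:R / (2 * q + q')%:R : R).
    exists (2 * p + p')%N, (2 * q + q')%N; split => //; first by lia.
    rewrite /coprime eqn_leq gcdn_gt0 q20 orbT andbT.
    apply: dvdn_leq => //.
    (* The mediant is reduced because $g$ divides two products that differ by 1. *)
    set g := gcdn _ _.
    have g1 : (g %| (2 * p + p') * q)%N by rewrite dvdn_mulr // dvdn_gcdl.
    have g2 : (g %| (2 * q + q') * p)%N by rewrite dvdn_mulr // dvdn_gcdr.
    case: det => det.
      have E : ((2 * p + p') * q = (2 * q + q') * p + 1)%N by lia.
      by move: g1; rewrite E dvdn_addr.
    have E : ((2 * q + q') * p = (2 * p + p') * q + 1)%N by lia.
    by move: g2; rewrite E dvdn_addr.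
  have /sub[_ [[a [b [_ _ _ ab ->]]] _]] :
      `]Num.min A C, Num.max A C[%classic ((2 * p + p')%:R / (2 * q + q')%:R : R).
    rewrite /= in_itv/= /A /C gt_min lt_max !ltr_nat_frac //.
    by case: det => det; apply/andP; split; apply/orP; [left|right|right|left]; lia.
  rewrite /= in_itv/= => abm; exact: ab abm.
- move=> lq z; rewrite /= in_itv/= => /andP[zmin zmax].
  (* A Farey fraction inside the interval would have a denominator of at least $q_n+(q_n+q_{n-1})$,
     which exceeds $l+1$. *)
  have no_farey c : farey_fraction l c -> Num.min A C < c < Num.max A C -> False.
    move=> [u [v [uv vl v0 _ ->]]]; case: det => det.
      have ltAC : A < C by rewrite ltr_nat_frac // -det.
      rewrite (min_l (ltW ltAC)) (max_r (ltW ltAC)) !ltr_nat_frac // => /andP[H1 H2].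
      by have := frac_between_den (esym det) H1 H2; lia.
    have ltCA : C < A by rewrite ltr_nat_frac // -det.
    rewrite (min_r (ltW ltCA)) (max_l (ltW ltCA)) !ltr_nat_frac // => /andP[H1 H2].
    by have := frac_between_den (esym det) H1 H2; lia.
  have [a [b [fa fb /andP[ax xb] ab]]] := farey_itv_exists l x01 xirr.
  (* If $z$ were outside, $a$ or $b$ would separate it from $x$ and so be a Farey fraction inside
     the interval. *)
  exists `]a, b[%classic; last first.
    rewrite /= in_itv/=; apply/andP; split; rewrite ltNge; apply/negP => H.
      by apply: (no_farey a fa); rewrite (lt_le_trans zmin H) (lt_trans ax xmax).
    by apply: (no_farey b fb); rewrite (lt_trans xmin xb) (le_lt_trans H zmax).
  split; last by rewrite /= in_itv/= ax xb.
  by exists a, b; split => //; apply: lt_trans ax xb.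
Qed.

(** By the criterion the largest admissible depth is $2q_n+q_{n-1}-2$. *)
Lemma lochs_index_bounds x n : (0 < n)%N -> x \in `]0, 1[ -> irrational x ->
  (cf_q x n)%:R <= lochs_index n x (@CF R) (@Farey R) <= 3 * (cf_q x n)%:R.
Proof.
move=> n0 x01 xirr.
have q'q := cf_q_prev_le n x01 xirr.
have q0 := cf_q_gt0 n x01 xirr.
(* With $q_{n-1} \ge 1$ the depth $q_n$ is admissible. At $n=0$ it is not, since $q_{-1}=0$. *)
have q'0 : (0 < cf_q_prev x n)%N.
  case: n n0 {q'q q0} => // n _.
  by apply: cf_recQ_gt0 => i _; apply: cf_digit_gt0.
have ub : ubound [set l%:R | l in [set l : nat |
    cell (@CF R) n x `<=` cell (@Farey R) l x]] (3 * (cf_q x n)%:R : R).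
  move=> _ [l /= /(cf_interval_sub_farey _ n0 x01 xirr) lq <-].
  by rewrite -(natrM _ 3) ler_nat; lia.
rewrite /lochs_index; set S := [set _ | _ in _] in ub *.
have mem : S (cf_q x n)%:R.
  exists (cf_q x n) => //=; apply/cf_interval_sub_farey => //; lia.
apply/andP; split; last by apply: ge_sup => //; exists (cf_q x n)%:R.
by apply: ub_le_sup => //; exists (3 * (cf_q x n)%:R).
Qed.

End lochs_index.

(** * Cylinders and sums over words *)

(** Digits are numbered from 1, as in [cf_rec], whereas [nth] counts from 0. *)
Definition word_digit (w : seq nat) (i : nat) : nat := nth 0%N w i.-1.

Definition word_q (w : seq nat) : nat := cf_rec (word_digit w) 0 1 (size w).+1.

Definition word_q_prev (w : seq nat) : nat := cf_rec (word_digit w) 0 1 (size w).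

Definition pos_word (w : seq nat) : bool := all (leq 1) w.

Lemma pos_word_digit w : pos_word w ->
  forall i, (0 < i <= size w)%N -> (0 < word_digit w i)%N.
Proof. by move=> /all_nthP wP [|i] // Hi; apply: (wP 0%N). Qed.

Lemma word_q_gt0 w : pos_word w -> (0 < word_q w)%N.
Proof. by move=> /pos_word_digit; apply: cf_recQ_gt0. Qed.

Lemma word_q_prev_le w : pos_word w -> (word_q_prev w <= word_q w)%N.
Proof. by move=> /pos_word_digit; apply: cf_recQ_leS. Qed.

Lemma word_q_cat u v : pos_word u -> pos_word v ->
  (word_q u * word_q v <= word_q (u ++ v) <= 2 * (word_q u * word_q v))%N.
Proof.
move=> u0 v0.
have := @cf_recQ_mul (word_digit (u ++ v)) (size u) (size v).
rewrite -size_cat => /(_ (pos_word_digit _)).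
have -> : cf_rec (word_digit (u ++ v)) 0 1 (size u).+1 = word_q u.
  by apply: eq_cf_rec => -[|i] // Hi; rewrite /word_digit nth_cat /= (_ : (i < _)%N).
have -> : cf_rec (fun i => word_digit (u ++ v) (i + size u)%N) 0 1 (size v).+1 = word_q v.
  apply: eq_cf_rec => -[|i] // Hi.
  by rewrite /word_digit /= nth_cat ltnNge leq_addl /= addnK.
by apply; rewrite /pos_word all_cat -!/(pos_word _) u0.
Qed.

Lemma word_q_cons a w : pos_word (a :: w) -> (a * word_q w <= word_q (a :: w))%N.
Proof.
move=> aw; have /andP[a0 w0] : pos_word [:: a] && pos_word w by rewrite /pos_word /= andbT.
have /andP[H _] := word_q_cat a0 w0.
by apply: leq_trans H; rewrite leq_mul2r /word_q /= /cf_rec /word_digit /= muln1 addn0 leqnn orbT.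
Qed.

Section cylinder.
Context {R : realType}.
Notation mu := (@lebesgue_measure R).
Implicit Types (x : R) (w : seq nat).

Lemma countable_rational : countable (@rational R).
Proof. rewrite /rational; apply: (card_le_trans (card_image_le _ _)); exact: countableP. Qed.

Lemma measurable_irrational : measurable (@irrational R).
Proof.
apply: measurableC; apply: countable_measurable => //; exact: countable_rational.
Qed.

Lemma measure_irrational (I : set R) : measurable I -> mu (I `&` irrational) = mu I.
Proof.
move=> mI; have mrat : measurable (@rational R).
  by rewrite -[rational]setCK; apply: measurableC; exact: measurable_irrational.
rewrite -[in RHS](setUIDK I irrational) /irrational setDE setCK measureU0 //.
- by apply: measurableI => //; exact: measurable_irrational.
- exact: measurableI.
- apply: countable_lebesgue_measure0; apply: sub_countable countable_rational.
  by apply: subset_card_le => x [].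
Qed.

Definition cylinder w : set R :=
  [set x | [/\ x \in `]0, 1[, irrational x &
     forall i, (0 < i <= size w)%N -> cf_digit x i = word_digit w i]].

(** The distance between $p_n/q_n$ and $(p_n+p_{n-1})/(q_n+q_{n-1})$, whose determinant is $\pm
    1$. *)
Definition cylinder_length w : R := ((word_q w * (word_q w + word_q_prev w))%:R)^-1.

(** The partition interval of a point depends on its digits only; conversely, the inverse branch
    given by the word produces points with these digits. *)
Lemma cylinderE w : pos_word w ->
  let A : R := (cf_rec (word_digit w) 1 0 (size w).+1)%:R / (word_q w)%:R in
  let C : R := (cf_rec (word_digit w) 1 0 (size w).+1
                + cf_rec (word_digit w) 1 0 (size w))%:R /
               (word_q w + word_q_prev w)%:R in
  cylinder w = `]Num.min A C, Num.max A C[%classic `&` irrational.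
Proof.
move=> w0 A C; have d0 := pos_word_digit w0.
apply/seteqP; split=> x.
- move=> [x01 xirr xw]; split => //; have := cf_interval_refl (size w) x01 xirr.
  rewrite /cf_interval /cf_p /cf_q /cf_p_prev /cf_q_prev.
  have H u v : cf_rec (cf_digit x) u v (size w).+1 = cf_rec (word_digit w) u v (size w).+1.
    by apply: eq_cf_rec => i Hi; apply: xw; lia.
  have H' u v : cf_rec (cf_digit x) u v (size w) = cf_rec (word_digit w) u v (size w).
    by apply: eq_cf_rec => i Hi; apply: xw; lia.
  by rewrite !H !H'.
- move=> [xI xirr]; have [t t01 xE] := (cf_itv_mobius x d0).1 xI.
  split=> //; rewrite xE; [exact: cf_mobius_itv|exact: cf_mobius_digit].
Qed.

Lemma measurable_cylinder w : pos_word w -> measurable (cylinder w).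
Proof.
by move=> w0; rewrite cylinderE //; apply: measurableI => //; exact: measurable_irrational.
Qed.

Lemma measure_cylinder w : pos_word w -> mu (cylinder w) = (cylinder_length w)%:E.
Proof.
move=> w0; rewrite cylinderE // measure_irrational // lebesgue_measure_itv /=.
have q0 := word_q_gt0 w0.
have := cf_rec_det_mediant (word_digit w) (size w).
rewrite -/(word_q w) -/(word_q_prev w) /cylinder_length.
move: (word_q w) (word_q_prev w) q0 => q q' q0.
move: (cf_rec _ _ _ _) (cf_rec _ _ _ _) => p' p det.
have s0 : (0 < q + q')%N by rewrite addn_gt0 q0.
have qR : 0 < q%:R :> R by rewrite ltr0n.
have sR : 0 < (q + q')%:R :> R by rewrite ltr0n.
have divB (a b c d : R) : b != 0 -> d != 0 -> a / b - c / d = (a * d - c * b) / (b * d).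
  by move=> b0 d0; field; rewrite b0 d0.
case: det => det.
- have lt : p%:R / q%:R < (p + p')%:R / (q + q')%:R :> R.
    by rewrite ltr_nat_frac // -det.
  rewrite (min_l (ltW lt)) (max_r (ltW lt)) lte_fin lt -EFinB divB ?gt_eqF //.
  by rewrite -!natrM -det -natrB // subSnn mulnC div1r.
- have lt : (p + p')%:R / (q + q')%:R < p%:R / q%:R :> R.
    by rewrite ltr_nat_frac // -det.
  rewrite (min_r (ltW lt)) (max_l (ltW lt)) lte_fin lt -EFinB divB ?gt_eqF //.
  by rewrite -!natrM -det -natrB // subSnn div1r.
Qed.

Lemma cylinder_length_ge0 w : 0 <= cylinder_length w.
Proof. by rewrite invr_ge0. Qed.

Lemma cylinder_length_le w : pos_word w -> cylinder_length w <= ((word_q w)%:R ^+ 2)^-1.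
Proof.
move=> w0; have q0 := word_q_gt0 w0.
rewrite lef_pV2 ?posrE ?exprn_gt0 ?ltr0n ?muln_gt0 ?addn_gt0 ?q0 //.
by rewrite -natrX ler_nat; nia.
Qed.

Lemma cylinder_length_ge w : pos_word w -> (2 * (word_q w)%:R ^+ 2)^-1 <= cylinder_length w.
Proof.
move=> w0; have q0 := word_q_gt0 w0; have := word_q_prev_le w0 => q'q.
rewrite lef_pV2 ?posrE ?mulr_gt0 ?exprn_gt0 ?ltr0n ?muln_gt0 ?addn_gt0 ?q0 //.
by rewrite -natrX -natrM ler_nat; nia.
Qed.

(** A cylinder length lies between $1/(2q^2)$ and $1/q^2$, and $q(uv) \ge q(u)q(v)$. The lower
    bounds for $u$ and for $v$ each cost a factor 2. *)
Lemma cylinder_length_cat u v : pos_word u -> pos_word v ->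
  cylinder_length (u ++ v) <= 4 * (cylinder_length u * cylinder_length v).
Proof.
move=> u0 v0.
have uv0 : pos_word (u ++ v) by rewrite /pos_word all_cat -!/(pos_word _) u0.
have /andP[quv _] := word_q_cat u0 v0.
have qu := word_q_gt0 u0; have qv := word_q_gt0 v0.
apply: (le_trans (cylinder_length_le uv0)).
have Hu := cylinder_length_ge u0; have Hv := cylinder_length_ge v0.
have H0 : 0 <= (2 * (word_q u)%:R ^+ 2 : R)^-1 by rewrite invr_ge0.
have H1 : 0 <= (2 * (word_q v)%:R ^+ 2 : R)^-1 by rewrite invr_ge0.
apply: (@le_trans _ _ (4 * ((2 * (word_q u)%:R ^+ 2)^-1 * (2 * (word_q v)%:R ^+ 2)^-1))).
  have -> : 4 * ((2 * (word_q u)%:R ^+ 2)^-1 * (2 * (word_q v)%:R ^+ 2)^-1)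
      = (((word_q u)%:R * (word_q v)%:R) ^+ 2)^-1 :> R.
    by field; rewrite !pnatr_eq0 -!lt0n qu qv.
  rewrite lef_pV2 ?posrE ?exprn_gt0 ?mulr_gt0 ?ltr0n //; last exact: word_q_gt0.
  by rewrite lerXn2r ?nnegrE ?mulr_ge0 // -natrM ler_nat.
by rewrite ler_wpM2l // ler_pM.
Qed.

Definition cf_word x n : seq nat := mkseq (fun i => cf_digit x i.+1) n.

Lemma pos_cf_word x n : x \in `]0, 1[ -> irrational x -> pos_word (cf_word x n).
Proof.
move=> x01 xirr; apply/allP => a /mapP[i _ ->]; exact: cf_digit_gt0.
Qed.

Lemma cf_word_digit x n i : (0 < i <= n)%N -> word_digit (cf_word x n) i = cf_digit x i.
Proof. by case: i => // i Hi; rewrite /word_digit nth_mkseq. Qed.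

Lemma cylinder_cf_word x n : x \in `]0, 1[ -> irrational x -> cylinder (cf_word x n) x.
Proof.
by move=> x01 xirr; split => // i; rewrite size_mkseq => Hi; rewrite cf_word_digit.
Qed.

Lemma cylinder_cf_wordE x w : cylinder w x -> w = cf_word x (size w).
Proof.
move=> [_ _ xw]; apply: (@eq_from_nth _ 0%N); first by rewrite size_mkseq.
by move=> i iw; rewrite nth_mkseq // (xw i.+1).
Qed.

Lemma word_q_cf_word x n : word_q (cf_word x n) = cf_q x n.
Proof.
rewrite /word_q /cf_q size_mkseq; apply: eq_cf_rec => i Hi.
by rewrite cf_word_digit //; lia.
Qed.

(** An event that depends on $x$ only through $q_n$ is a union of cylinders of $n$ digits, so its
    measure is a sum over words. *)
Definition cf_event (n : nat) (P : pred nat) : set R :=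
  [set x : R | [/\ x \in `]0, 1[, irrational x & P (cf_q x n)]].

End cylinder.

(** * Sums over words of positive digits *)

Section word_sum.
Context {R : realType}.
Notation mu := (@lebesgue_measure R).
Local Open Scope ereal_scope.
Implicit Types (F G : seq nat -> \bar R) (f g : seq nat -> R).

(** Iterated series, one per letter, so that splitting a word into blocks is an induction on the
    length. The index [a] stands for the digit $a+1$. *)
Fixpoint word_sum (n : nat) F : \bar R :=
  if n is m.+1 then \sum_(0 <= a <oo) word_sum m (fun w => F (a.+1 :: w)) else F [::].

Lemma word_sum_ge0 n F : (forall w, size w = n -> pos_word w -> 0 <= F w) ->
  0 <= word_sum n F.
Proof.
elim: n F => [|n IH] F F0 /=; first exact: F0.
by apply: nneseries_ge0 => a _ _; apply: IH => w wn w0; apply: F0 => //=; rewrite wn.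
Qed.

Lemma le_word_sum n F G : (forall w, size w = n -> pos_word w -> 0 <= F w) ->
  (forall w, size w = n -> pos_word w -> F w <= G w) -> word_sum n F <= word_sum n G.
Proof.
elim: n F G => [|n IH] F G F0 FG /=; first exact: FG.
apply: lee_nneseries => [a _ _|a _].
  by apply: word_sum_ge0 => w wn w0; apply: F0 => //=; rewrite wn.
by apply: IH => w wn w0; [apply: F0|apply: FG] => //=; rewrite wn.
Qed.

Lemma eq_word_sum n F G : (forall w, size w = n -> pos_word w -> F w = G w) ->
  word_sum n F = word_sum n G.
Proof.
elim: n F G => [|n IH] F G FG /=; first exact: FG.
by apply: eq_eseriesr => a _; apply: IH => w wn w0; apply: FG => //=; rewrite wn.
Qed.

Lemma word_sumZl n (c : R) F : (forall w, size w = n -> pos_word w -> 0 <= F w) ->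
  word_sum n (fun w => c%:E * F w) = c%:E * word_sum n F.
Proof.
elim: n F => [|n IH] F F0 //=; rewrite -nneseriesZl => [|a _].
  by apply: eq_eseriesr => a _; apply: IH => w wn w0; apply: F0 => //=; rewrite wn.
by apply: word_sum_ge0 => w wn w0; apply: F0 => //=; rewrite wn.
Qed.

Lemma word_sumD n F G : (forall w, size w = n -> pos_word w -> 0 <= F w) ->
  (forall w, size w = n -> pos_word w -> 0 <= G w) ->
  word_sum n (fun w => F w + G w) = word_sum n F + word_sum n G.
Proof.
elim: n F G => [|n IH] F G F0 G0 //=; rewrite -nneseriesD.
- apply: eq_eseriesr => a _.
  by apply: IH => w wn w0; [apply: F0|apply: G0] => //=; rewrite wn.
- by move=> a _ _; apply: word_sum_ge0 => w wn w0; apply: F0 => //=; rewrite wn.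
- by move=> a _ _; apply: word_sum_ge0 => w wn w0; apply: G0 => //=; rewrite wn.
Qed.

Lemma word_sum_addn m n F :
  word_sum (m + n) F = word_sum m (fun u => word_sum n (fun v => F (u ++ v))).
Proof. by elim: m F => [|m IH] F //=; apply: eq_eseriesr => a _; rewrite IH. Qed.

(** By induction on the length: the first letter splits the union into countably many disjoint
    pieces, each a union over words with one letter less. *)
Lemma word_sum_measure n (A : seq nat -> set R) :
  (forall w, size w = n -> pos_word w -> measurable (A w)) ->
  (forall u v, size u = n -> size v = n -> A u `&` A v !=set0 -> u = v) ->
  let U := \bigcup_(w in [set w | size w = n /\ pos_word w]) A w in
  measurable U /\ word_sum n (mu \o A) = mu U.
Proof.
elim: n A => [|n IH] A mA tA U.
  have -> : U = A [::].
    apply/seteqP; split=> x; first by move=> [w [/size0nil -> _]].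
    by move=> xA; exists [::].
  by split=> //; apply: mA.
pose V a := \bigcup_(w in [set w | size w = n /\ pos_word w]) A (a.+1 :: w).
have {}IH a : measurable (V a) /\ word_sum n (fun w => mu (A (a.+1 :: w))) = mu (V a).
  apply: (IH (fun w => A (a.+1 :: w))) => [w wn w0|u v un vn]; last first.
    by move=> uv; have [] // : a.+1 :: u = a.+1 :: v by apply: tA; rewrite /= ?un ?vn.
  by apply: mA => //=; rewrite wn.
have UE : U = \bigcup_a V a.
  apply/seteqP; split=> x.
    move=> [[|[|a] w] [] //= [wn] w0 xA]; exists a => //; by exists w.
  move=> [a _ [w [wn w0] xA]]; exists (a.+1 :: w) => //=; by rewrite wn.
rewrite UE; split; first by apply: bigcupT_measurable => a; have [] := IH a.
rewrite /= measure_bigcup.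
- rewrite (@eq_eseriesl _ _ (fun i : nat => i \in [set: nat])) => [|a]; last by rewrite in_setT.
  by apply: eq_eseriesr => a _; have [_] := IH a.
- by move=> a _; have [] := IH a.
- move=> a b _ _ [x [[u [un _] xu] [v [vn _] xv]]].
  by have [] : a.+1 :: u = b.+1 :: v by apply: tA; rewrite /= ?un ?vn //; exists x.
Qed.

Lemma word_sum_event n (P : pred nat) :
  measurable (@cf_event R n P) /\
  word_sum n (fun w => (cylinder_length w * (P (word_q w))%:R)%:E) = mu (cf_event n P).
Proof.
(* Cylinders whose denominator violates [P] are replaced by the empty set, which turns the indicator
   in the sum into a measure. *)
pose A w : set R := if P (word_q w) then cylinder w else set0.
have mA w : size w = n -> pos_word w -> measurable (A w).
  by move=> _ w0; rewrite /A; case: ifP => // _; exact: measurable_cylinder.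
have tA u v : size u = n -> size v = n -> A u `&` A v !=set0 -> u = v.
  rewrite /A => un vn [x]; case: ifP => _; case: ifP => _ [] //.
  by move=> /cylinder_cf_wordE -> /cylinder_cf_wordE ->; rewrite un vn.
have [mU UE] := word_sum_measure mA tA.
have EE : cf_event n P = \bigcup_(w in [set w | size w = n /\ pos_word w]) A w.
  apply/seteqP; split=> x.
  - move=> [x01 xirr Px]; exists (cf_word x n).
      by split; [rewrite /= size_mkseq|exact: pos_cf_word].
    by rewrite /A word_q_cf_word Px; exact: cylinder_cf_word.
  - move=> [w [wn w0]]; rewrite /A; case: ifP => // Pw xw.
    by have [x01 xirr _] := xw; split => //; rewrite -word_q_cf_word -wn -cylinder_cf_wordE.
split; rewrite EE // -UE; apply: eq_word_sum => w _ w0.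
by rewrite /= /A; case: (P _); rewrite ?mulr1 ?mulr0 ?measure_cylinder ?measure0.
Qed.
Lemma cf_event_le1 n (P : pred nat) : mu (cf_event n P) <= 1.
Proof.
have [mE _] := word_sum_event n P.
apply: (@le_trans _ _ (mu `]0%R, 1%R[)); first by apply: le_measure; rewrite ?inE // => x [].
by rewrite lebesgue_measure_itv /= lte_fin ltr01 oppr0 adde0.
Qed.

End word_sum.

(** * Exponential moments and large deviations *)

Section moments.
Context {R : realType}.
Notation mu := (@lebesgue_measure R).
Local Notation word_exp t w := (expR (t * ln (word_q w)%:R) : R).
Implicit Types (f g : seq nat -> R).

(** Cutting a word of length $kn$ into $k$ blocks costs a factor $K$ and a block sum of at most $r$
    for each block. *)
Lemma word_sum_submult f (r K : R) (n k : nat) :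
  0 <= K -> (forall w, pos_word w -> 0 <= f w) -> f [::] <= 1 ->
  (forall u v, pos_word u -> pos_word v -> f (u ++ v) <= K * (f u * f v)) ->
  (word_sum n (EFin \o f) <= r%:E)%E ->
  (word_sum (k * n) (EFin \o f) <= ((K * r) ^+ k)%:E)%E.
Proof.
move=> K0 f0 f1 fK fr.
have r0 : 0 <= r.
  rewrite -lee_fin; apply: le_trans fr; apply: word_sum_ge0 => w _ w0 /=.
  by rewrite lee_fin f0.
elim: k => [|k IH]; first by rewrite mul0n /= lee_fin.
rewrite mulSn word_sum_addn.
apply: (@le_trans _ _ (word_sum n (fun u => ((K * r) ^+ k * K)%:E * (f u)%:E))%E).
  apply: le_word_sum => u un u0.
    apply: word_sum_ge0 => v vn v0; rewrite lee_fin; apply: f0.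
    by rewrite /pos_word all_cat -!/(pos_word _) u0.
  apply: (@le_trans _ _ (word_sum (k * n) (fun v => (K * f u)%:E * (EFin \o f) v))%E).
    apply: le_word_sum => v vn v0 /=.
      by rewrite lee_fin; apply: f0; rewrite /pos_word all_cat -!/(pos_word _) u0.
    by rewrite -EFinM lee_fin -mulrA fK.
  rewrite word_sumZl => [|v vn v0]; last by rewrite lee_fin f0.
  have -> : (((K * r) ^+ k * K)%:E * (f u)%:E = (K * f u)%:E * ((K * r) ^+ k)%:E)%E.
    by rewrite -!EFinM; congr _%:E; ring.
  apply: lee_wpmul2l => //.
  by rewrite lee_fin mulr_ge0 ?f0.
rewrite word_sumZl => [|v vn v0]; last by rewrite lee_fin f0.
apply: (@le_trans _ _ (((K * r) ^+ k * K)%:E * r%:E)%E).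
  by apply: lee_wpmul2l => //; rewrite lee_fin mulr_ge0 ?exprn_ge0 ?mulr_ge0.
by rewrite -EFinM -mulrA exprSr.
Qed.

(** This is $\sum_{a\ge1} a^{-3/2} \le 3$, by comparison with the integral. *)
Lemma series_mul_sqrt_inv_le3 :
  (\sum_(0 <= a <oo) ((a.+1%:R * Num.sqrt a.+1%:R : R)^-1)%:E <= 3%:E)%E.
Proof.
apply: lime_le.
  by apply: is_cvg_nneseries => a _ _; rewrite lee_fin invr_ge0 mulr_ge0 ?sqrtr_ge0.
apply: nearW => n; rewrite sumEFin lee_fin.
(* The term $2/\sqrt{m+1}$ is the integral of $x^{-3/2}$ over the remaining tail; it makes the
   induction telescope. *)
suff H : forall m, \sum_(0 <= a < m.+1) (a.+1%:R * Num.sqrt a.+1%:R : R)^-1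
    <= 3 - 2 / Num.sqrt m.+1%:R.
  case: n => [|n]; first by rewrite big_geq.
  apply: (le_trans (H n)); rewrite gerBl; exact: divr_ge0 (sqrtr_ge0 _).
elim=> [|m IH]; first by rewrite big_nat1 mul1r sqrtr1 invr1 mulr1; lra.
rewrite big_nat_recr //=.
apply: le_trans (lerD IH (lexx _)) _.
set u := Num.sqrt m.+1%:R; set v := Num.sqrt m.+2%:R.
have u0 : 0 < u by rewrite sqrtr_gt0.
have v0 : 0 < v by rewrite sqrtr_gt0.
have uE : u ^+ 2 = m.+1%:R by rewrite sqr_sqrtr.
have vE : m.+2%:R = v ^+ 2 by rewrite sqr_sqrtr.
have uv1 : v ^+ 2 = u ^+ 2 + 1 by rewrite -vE uE natr1.
have uv : u <= v by rewrite ler_wsqrtr // ler_nat.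
rewrite vE -subr_ge0.
have -> : 3 - 2 / v - (3 - 2 / u + (v ^+ 2 * v)^-1) =
    (2 * v ^+ 2 * (v - u) - u) / (u * v ^+ 3).
  by field; rewrite !gt_eqF.
apply: divr_ge0; last by rewrite mulr_ge0 ?exprn_ge0 // ltW.
(* Multiplication by $u+v$ turns $v-u$ into $v^2-u^2=1$. *)
rewrite subr_ge0 -(ler_pM2r (addr_gt0 u0 v0)).
have -> : 2 * v ^+ 2 * (v - u) * (u + v) = 2 * v ^+ 2 * (v ^+ 2 - u ^+ 2) by ring.
rewrite uv1; nra.
Qed.

(** Since $q(aw) \ge a\,q(w)$, the sum of $q^{-3/2}$ is at most a product of $n$ copies of $\sum_a
    a^{-3/2}$. *)
Lemma word_sum_sqrt_le n :
  (word_sum n (fun w => (((word_q w)%:R * Num.sqrt (word_q w)%:R : R)^-1)%:E) <= (3 ^+ n)%:E)%E.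
Proof.
elim: n => [|n IH] /=.
  by rewrite /word_q /= /cf_rec /= mul1r sqrtr1 invr1.
pose F w : \bar R := (((word_q w)%:R * Num.sqrt (word_q w)%:R : R)^-1)%:E.
pose g a : R := (a.+1%:R * Num.sqrt a.+1%:R : R)^-1.
have g0 a : 0 <= g a by rewrite invr_ge0 mulr_ge0 // sqrtr_ge0.
have F0 w : (0%:E <= F w)%E by rewrite lee_fin invr_ge0 mulr_ge0 // sqrtr_ge0.
apply: (@le_trans _ _ (\sum_(0 <= a <oo) ((3 ^+ n)%:E * (g a)%:E))%E).
  apply: lee_nneseries => [a _ _|a _]; first by apply: word_sum_ge0.
  apply: (@le_trans _ _ (word_sum n (fun w => (g a)%:E * F w)%E)).
    apply: le_word_sum => w wn w0; first exact: F0.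
    have aw0 : pos_word (a.+1 :: w) by [].
    rewrite -EFinM lee_fin /g -invfM lef_pV2 ?posrE ?mulr_gt0 ?sqrtr_gt0 ?ltr0n ?word_q_gt0 //.
    rewrite mulrACA -sqrtrM // -natrM ler_pM ?ler_nat ?mulr_ge0 ?sqrtr_ge0 //.
      exact: word_q_cons.
    by rewrite ler_wsqrtr // ler_nat word_q_cons.
  rewrite word_sumZl // muleC.
  by apply: lee_wpmul2r => //; rewrite lee_fin.
rewrite nneseriesZl => [|a _]; last by rewrite lee_fin.
rewrite [in leRHS]exprSr EFinM; apply: lee_wpmul2l; last exact: series_mul_sqrt_inv_le3.
by rewrite lee_fin exprn_ge0.
Qed.

Lemma ln_word_q_ge0 w : 0 <= ln (word_q w)%:R :> R.
Proof. by case: (word_q w) => [|q]; [rewrite ln0|rewrite ln_ge0 ?ler1n]. Qed.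

(** This bounds $\int \sqrt{q_n}$: a cylinder has length at most $q^{-2}$, which leaves the sum of
    $q^{-3/2}$. *)
Lemma word_sum_half_moment n :
  (word_sum n (fun w => (cylinder_length w * word_exp 2^-1 w)%:E) <= (3 ^+ n)%:E)%E.
Proof.
apply: le_trans (word_sum_sqrt_le n).
apply: le_word_sum => w _ w0; first by rewrite lee_fin mulr_ge0 ?expR_ge0 ?cylinder_length_ge0.
have q0 : 0 < (word_q w)%:R :> R by rewrite ltr0n word_q_gt0.
have E : word_exp 2^-1 w = Num.sqrt (word_q w)%:R.
  apply/eqP; rewrite -(@eqrXn2 _ 2) ?expR_ge0 ?sqrtr_ge0 // sqr_sqrtr ?ltW //.
  by rewrite -expRM_natl mulrA divff // mul1r lnK // posrE.
rewrite lee_fin E; apply: le_trans (ler_wpM2r (sqrtr_ge0 _) (cylinder_length_le w0)) _.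
rewrite le_eqVlt; apply/orP; left; apply/eqP.
have s0 : 0 < Num.sqrt (word_q w)%:R :> R by rewrite sqrtr_gt0.
have := esym (sqr_sqrtr (ltW q0)).
by move: s0; move: (Num.sqrt _) => s s0 ->; field; rewrite gt_eqF.
Qed.

Lemma word_sum_length_le1 n : (word_sum n (fun w => (@cylinder_length R w)%:E) <= 1)%E.
Proof.
have [_] := @word_sum_event R n predT.
rewrite (@eq_word_sum _ _ _ (fun w => (@cylinder_length R w)%:E)) => [->|w _ _]; last first.
  by rewrite mulr1.
exact: cf_event_le1.
Qed.

(** Markov's inequality for $q_{kn}^t$, whose integral is at most $(8r)^k$; then $8r e^{-b} \le
    1/2$. Both signs of $t$ are allowed, for deviations on either side. *)
Lemma chernoff (t b r : R) (n k : nat) (P : pred nat) :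
  `|t| <= 1 -> (word_sum n (fun w => (cylinder_length w * word_exp t w)%:E) <= r%:E)%E ->
  16 * r <= expR b -> (forall q, (0 < q)%N -> P q -> k%:R * b <= t * ln q%:R) ->
  (mu (cf_event (k * n) P) <= (2^-1 ^+ k)%:E)%E.
Proof.
move=> t1 Hr rb HP; have [_ <-] := @word_sum_event R (k * n) P.
have r0 : 0 <= r.
  rewrite -lee_fin; apply: le_trans Hr; apply: word_sum_ge0 => w _ w0 /=.
  by rewrite lee_fin mulr_ge0 ?expR_ge0 ?cylinder_length_ge0.
pose f w : R := cylinder_length w * word_exp t w.
(* The factor 8 is 4 from the cylinder lengths times 2 from $q^t$, as $q(uv)$ is determined up to a
   factor 2 and $|t| \le 1$. *)
have fcat u v : pos_word u -> pos_word v -> f (u ++ v) <= 8 * (f u * f v).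
  move=> u0 v0; rewrite /f.
  have -> : 8 * (cylinder_length u * word_exp t u * (cylinder_length v * word_exp t v)) =
    (4 * (cylinder_length u * cylinder_length v)) * (2 * (word_exp t u * word_exp t v)) by ring.
  apply: ler_pM; rewrite ?expR_ge0 ?cylinder_length_ge0 ?cylinder_length_cat //.
  have /andP[H1 H2] := word_q_cat u0 v0.
  have qu : 0 < (word_q u)%:R :> R by rewrite ltr0n word_q_gt0.
  have qv : 0 < (word_q v)%:R :> R by rewrite ltr0n word_q_gt0.
  have quv : 0 < (word_q (u ++ v))%:R :> R.
    by rewrite ltr0n word_q_gt0 // /pos_word all_cat -!/(pos_word _) u0.
  have L1 : ln (word_q u)%:R + ln (word_q v)%:R <= ln (word_q (u ++ v))%:R :> R.
    by rewrite -lnM ?posrE // -natrM ler_ln ?posrE ?ler_nat // natrM mulr_gt0.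
  have L2 : ln (word_q (u ++ v))%:R <= ln 2 + (ln (word_q u)%:R + ln (word_q v)%:R) :> R.
    rewrite -!lnM ?posrE ?mulr_gt0 // -!natrM ler_ln ?posrE ?ler_nat //.
    by rewrite !natrM !mulr_gt0.
  have ln2 : 0 <= ln 2 :> R by rewrite ln_ge0 // ler1n.
  rewrite -!expRD.
  apply: (@le_trans _ _ (expR (ln 2 + (t * ln (word_q u)%:R + t * ln (word_q v)%:R)))); last first.
    by rewrite [leLHS]expRD lnK ?posrE.
  rewrite ler_expR.
  move: L1 L2 ln2; move: (ln _) (ln _) (ln _) (ln _) => d a b' c.
  move: t1; rewrite ler_norml => /andP[t1 t2] L1 L2 ln2.
  by nra.
have f0 : f [::] <= 1.
  rewrite /f /cylinder_length /word_q /word_q_prev /= /cf_rec /=.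
  by rewrite ln1 mulr0 expR0 mulr1 ?muln1 ?addn0 invr1.
have fge0 w : 0 <= f w by rewrite mulr_ge0 ?expR_ge0 ?cylinder_length_ge0.
have := @word_sum_submult f r 8 n k (ler0n _ _) (fun w _ => fge0 w) f0 fcat Hr.
move=> Hk.
(* On the event, the indicator 1 is at most $e^{-kb}q^t$. *)
apply: (@le_trans _ _ (word_sum (k * n) (fun w => (expR (- (k%:R * b)))%:E * (f w)%:E)%E)).
  apply: le_word_sum => w wn w0; first by rewrite lee_fin mulr_ge0 // cylinder_length_ge0.
  rewrite -EFinM lee_fin /f mulrCA; apply: ler_wpM2l; first exact: cylinder_length_ge0.
  have := HP _ (word_q_gt0 w0); case: (P _) => /= [/(_ isT) Hq|_]; last first.
    by rewrite mulr_ge0 ?expR_ge0.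
  by rewrite -expRD -[leLHS]expR0 ler_expR; lra.
rewrite word_sumZl => [|v vn v0]; last by rewrite lee_fin fge0.
apply: (@le_trans _ _ ((expR (- (k%:R * b)))%:E * ((8 * r) ^+ k)%:E)%E).
  by apply: lee_wpmul2l => //; rewrite lee_fin expR_ge0.
rewrite -EFinM lee_fin -mulrN expRM_natl -exprMn.
apply: lerXn2r; rewrite ?nnegrE ?mulr_ge0 ?expR_ge0 //.
rewrite expRN mulrC ler_pdivrMr ?expR_gt0 //; lra.
Qed.

End moments.

(** * From convergence in probability to geometric deviation bounds *)

Section large_deviations.
Context {R : realType}.
Notation mu := (@lebesgue_measure R).

(* Here [y] is $\log q_n$ and [beta] the event that it is large. On this event
   $Y \le \lambda + Y^2 / \lambda$ for $Y = e^{cy/n}$, and $Y^2$ is controlled by the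
   moment of order 1/2, normalised by its bound $3^n$. *)
Lemma expR_truncate (c n y A lam : R) (beta : bool) : 0 < c -> 0 < n -> 4 * c <= n ->
  0 < lam -> (~~ beta -> c / n * y <= A) ->
  expR (c / n * y) <= expR A + beta%:R * lam
    + lam^-1 * expR (4 * c * ln 3) * (1 + expR (2^-1 * y) * expR (- (n * ln 3))).
Proof.
move=> c0 n0 cn lam0 Hb.
set z := expR (2^-1 * y) * _; have z0 : 0 <= z by rewrite mulr_ge0 ?expR_ge0.
have E0 : 0 <= lam^-1 * expR (4 * c * ln 3) * (1 + z).
  by rewrite !mulr_ge0 ?expR_ge0 ?addr_ge0 // invr_ge0 ltW.
case: beta Hb => [_|/(_ isT) yA]; last first.
  have : expR (c / n * y) <= expR A by rewrite ler_expR.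
  by rewrite /= mul0r; lra.
rewrite /= mul1r; set Y := expR (c / n * y).
have sq : Y ^+ 2 <= expR (4 * c * ln 3) * (1 + z).
  rewrite /Y -expRM_natl.
  have [zle|zge] := leP (2^-1 * y) (n * ln 3).
  - apply: (@le_trans _ _ (expR (4 * c * ln 3))); last first.
      by rewrite ler_peMr ?expR_ge0 // lerDl.
    rewrite ler_expR.
    have -> : 2 * (c / n * y) = (4 * c / n) * (2^-1 * y) by field; rewrite gt_eqF.
    have -> : 4 * c * ln 3 = (4 * c / n) * (n * ln 3) by field; rewrite gt_eqF.
    by rewrite ler_wpM2l // divr_ge0 ?ltW // mulr_gt0.
  - apply: (@le_trans _ _ (expR (4 * c * ln 3) * z)); last first.
      by rewrite ler_wpM2l ?expR_ge0 // lerDr.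
    rewrite /z -!expRD ler_expR.
    have -> : 2 * (c / n * y) = (4 * c / n) * (2^-1 * y - n * ln 3) + 4 * c * ln 3.
      by field; rewrite gt_eqF.
    have : 4 * c / n <= 1 by rewrite ler_pdivrMr // mul1r.
    move: (4 * c / n) => d d1.
    have : 0 < 2^-1 * y - n * ln 3 by rewrite subr_gt0.
    by nra.
have Y0 : 0 <= Y by exact: expR_ge0.
have : Y <= lam + lam^-1 * (expR (4 * c * ln 3) * (1 + z)).
  apply: (@le_trans _ _ (lam + lam^-1 * Y ^+ 2)); last by rewrite lerD2l ler_wpM2l // invr_ge0 ltW.
  rewrite -(ler_pM2l lam0) mulrDr mulrA divff ?gt_eqF // mul1r.
  by nra.
have := expR_ge0 A; rewrite mulrA; lra.
Qed.

(** Chernoff bound with $t=c/n$: convergence in probability gives $\int q_n^{c/n} \le 2e^A$ with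
    $A=c(H+\varepsilon/2)$, against the larger threshold $e^{c(H+\varepsilon)}$. *)
Lemma cf_q_upper_deviation (H eps : R) : 0 <= H -> 0 < eps ->
  (forall d : R, 0 < d -> exists N, forall n, (N <= n)%N ->
    (mu (cf_event n (fun q => n%:R * (H + eps / 2) < ln q%:R)%R) <= d%:E)%E) ->
  exists N, forall n k, (N <= n)%N ->
    (mu (cf_event (k * n)%N (fun q => (k * n)%:R * (H + eps) <= ln q%:R)%R)
      <= (2^-1 ^+ k)%:E)%E.
Proof.
move=> H0 eps0 prob.
(* Chosen so that $c\varepsilon/2=\ln 32$; here $32=16\cdot 2$ absorbs the 16 of [chernoff] and the
   2 of $2e^A$. *)
have [c cE] : {c : R | c = 2 * ln 32 / eps} by eexists.
have ln32 : 0 < ln 32 :> R by rewrite ln_gt0 // ltr1n.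
have c0 : 0 < c by rewrite cE divr_gt0 ?mulr_gt0.
(* This makes the factor $\lambda^{-1}e^{4c\ln 3}$ of the truncation equal to $1/4$. The probability
   $1/(2\lambda)$ below then makes the event contribute at most $1/2$. *)
have [lam lamE] : {lam : R | lam = 4 * expR (4 * c * ln 3)} by eexists.
have lam0 : 0 < lam by rewrite lamE mulr_gt0 ?expR_gt0.
have [N HN] := prob ((2 * lam)^-1) ltac:(by rewrite invr_gt0 mulr_gt0).
exists (maxn N (Num.truncn (4 * c)).+1) => n k; rewrite geq_max => /andP[/HN Pn cn].
have cn4 : 4 * c <= n%:R.
  by apply: le_trans (ltW (truncnS_gt _)) _; rewrite ler_nat.
have n0 : 0 < n%:R :> R by lra.
pose A := c * (H + eps / 2).
have t0 : 0 < c / n%:R by rewrite divr_gt0.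
apply: (@chernoff R (c / n%:R) (c * (H + eps)) (2 * expR A) n k).
- by rewrite gtr0_norm // ler_pdivrMr // mul1r; lra.
- pose beta w := n%:R * (H + eps / 2) < ln (word_q w)%:R :> R.
  have [e eE] : {e : R | e = lam^-1 * expR (4 * c * ln 3)} by eexists.
  have e0 : 0 <= e by rewrite eE mulr_ge0 ?expR_ge0 // invr_ge0 ltW.
  pose L w := (@cylinder_length R w).
  have L0 w : 0 <= L w by exact: cylinder_length_ge0.
  (* The truncation bound weighted by cylinder lengths, grouped into total mass, probability of
     [beta] and half moment. *)
  pose G w : \bar R := ((expR A + e)%:E * (L w)%:E + (lam%:E * (L w * (beta w)%:R)%:E
     + (e * expR (- (n%:R * ln 3)))%:E * (L w * expR (2^-1 * ln (word_q w)%:R))%:E))%E.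
  apply: (@le_trans _ _ (word_sum n G)).
    apply: le_word_sum => w wn w0; first by rewrite lee_fin mulr_ge0 ?expR_ge0.
    rewrite /G -!EFinM -!EFinD lee_fin.
    have := @expR_truncate c n%:R (ln (word_q w)%:R) A lam (beta w) c0 n0 cn4 lam0.
    have Hb : ~~ beta w -> c / n%:R * ln (word_q w)%:R <= A.
      rewrite -leNgt => Hw; rewrite /A -mulrA ler_wpM2l ?(ltW c0) //.
      by rewrite mulrC ler_pdivrMr // mulrC.
    move=> /(_ Hb) /(ler_wpM2l (L0 w)) /le_trans; apply.
    by rewrite -eE le_eqVlt; apply/orP; left; apply/eqP; ring.
  rewrite word_sumD; last 2 first.
    by move=> w _ _; rewrite -EFinM lee_fin mulr_ge0 // addr_ge0 ?expR_ge0.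
    move=> w _ _; rewrite -!EFinM -EFinD lee_fin; apply: addr_ge0;
      by rewrite !mulr_ge0 ?expR_ge0 // ltW.
  rewrite word_sumD; last 2 first.
    by move=> w _ _; rewrite -EFinM lee_fin !mulr_ge0 // ltW.
    by move=> w _ _; rewrite -EFinM lee_fin !mulr_ge0 ?expR_ge0.
  rewrite !word_sumZl; last 3 first.
    by move=> w _ _; rewrite lee_fin !mulr_ge0 ?expR_ge0.
    by move=> w _ _; rewrite lee_fin.
    by move=> w _ _; rewrite lee_fin !mulr_ge0.
  have [_ ->] := @word_sum_event R n (fun q => n%:R * (H + eps / 2) < ln q%:R).
  apply: (@le_trans _ _ ((expR A + e)%:E * 1 + (lam%:E * ((2 * lam)^-1)%:E +
     (e * expR (- (n%:R * ln 3)))%:E * (3 ^+ n)%:E))%E).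
    apply: leeD; last apply: leeD.
    + apply: lee_wpmul2l; last exact: word_sum_length_le1.
      by rewrite lee_fin addr_ge0 ?expR_ge0.
    + by apply: lee_wpmul2l => //; rewrite lee_fin ltW.
    + apply: lee_wpmul2l; last exact: word_sum_half_moment.
      by rewrite lee_fin mulr_ge0 ?expR_ge0.
  rewrite mule1 -!EFinM -!EFinD lee_fin.
  have -> : e = 4^-1.
    rewrite eE lamE; field; exact: lt0r_neq0 (expR_gt0 _).
  have -> : lam * (2 * lam)^-1 = 2^-1 by field; rewrite gt_eqF.
  have -> : (3 : R) ^+ n = expR (n%:R * ln 3) by rewrite expRM_natl lnK ?posrE.
  rewrite -mulrA -expRD addNr expR0 mulr1.
  (* The total is $e^A+1/4+1/2+1/4$, at most $2e^A$ because $A \ge 0$. *)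
  have : 1 <= expR A.
    rewrite -[leLHS]expR0 ler_expR mulr_ge0 ?ltW //; lra.
  lra.
- have -> : c * (H + eps) = A + ln 32.
    by rewrite /A cE; field; rewrite gt_eqF.
  rewrite expRD lnK ?posrE // mulrC; lra.
- move=> q q0 Hq.
  apply: le_trans (ler_wpM2l (ltW (divr_gt0 c0 n0)) Hq).
  rewrite natrM le_eqVlt; apply/orP; left; apply/eqP.
  by field; rewrite gt_eqF.
Qed.

(** The same argument with $t=-c/n$. The weight $q_n^t$ is at most 1, so the event of small $q_n$
    contributes at most its probability; this replaces the truncation. *)
Lemma cf_q_lower_deviation (H eps : R) : 0 < eps ->
  (forall d : R, 0 < d -> exists N, forall n, (N <= n)%N ->
    (mu (cf_event n (fun q => ln q%:R < n%:R * (H - eps / 2))%R) <= d%:E)%E) ->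
  exists N, forall n k, (N <= n)%N ->
    (mu (cf_event (k * n)%N (fun q => ln q%:R <= (k * n)%:R * (H - eps))%R)
      <= (2^-1 ^+ k)%:E)%E.
Proof.
move=> eps0 prob.
have [c cE] : {c : R | c = 2 * ln 32 / eps} by eexists.
have ln32 : 0 < ln 32 :> R by rewrite ln_gt0 // ltr1n.
have c0 : 0 < c by rewrite cE divr_gt0 ?mulr_gt0.
pose A := - (c * (H - eps / 2)).
(* With probability at most $e^A$ for the exceptional event, the moment is again at most $2e^A$. *)
have [N HN] := prob (expR A) (expR_gt0 _).
exists (maxn N (Num.truncn c).+1) => n k; rewrite geq_max => /andP[/HN Pn cn].
have cn1 : c <= n%:R.
  by apply: le_trans (ltW (truncnS_gt _)) _; rewrite ler_nat.
have n0 : 0 < n%:R :> R by lra.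
have t0 : 0 < c / n%:R by rewrite divr_gt0.
apply: (@chernoff R (- (c / n%:R)) (- (c * (H - eps))) (2 * expR A) n k).
- by rewrite normrN gtr0_norm // ler_pdivrMr // mul1r; lra.
- pose beta w := ln (word_q w)%:R < n%:R * (H - eps / 2) :> R.
  pose L w := (@cylinder_length R w).
  have L0 w : 0 <= L w by exact: cylinder_length_ge0.
  pose G w : \bar R := ((expR A)%:E * (L w)%:E + (L w * (beta w)%:R)%:E)%E.
  apply: (@le_trans _ _ (word_sum n G)).
    apply: le_word_sum => w wn w0; first by rewrite lee_fin mulr_ge0 ?expR_ge0.
    rewrite /G -!EFinM -!EFinD lee_fin mulrC -mulrC [expR A * _]mulrC -mulrDr ler_wpM2l //.
    have [b|nb] := boolP (beta w).
      have : expR (- (c / n%:R) * ln (word_q w)%:R) <= 1.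
        rewrite -[leRHS]expR0 ler_expR mulNr oppr_le0.
        exact: mulr_ge0 (ltW t0) (ln_word_q_ge0 w).
      by have := expR_ge0 A; rewrite mulr1n; lra.
    rewrite mulr0n addr0 ler_expR /A mulNr lerN2 -mulrA ler_wpM2l ?(ltW c0) //.
    by rewrite [n%:R^-1 * _]mulrC ler_pdivlMr // mulrC leNgt.
  rewrite word_sumD; last 2 first.
    by move=> w _ _; rewrite -EFinM lee_fin mulr_ge0 ?expR_ge0.
    by move=> w _ _; rewrite lee_fin mulr_ge0.
  rewrite !word_sumZl; last by move=> w _ _; rewrite lee_fin.
  have [_ ->] := @word_sum_event R n (fun q => ln q%:R < n%:R * (H - eps / 2)).
  apply: (@le_trans _ _ ((expR A)%:E * 1 + (expR A)%:E)%E).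
    apply: leeD => //.
    apply: lee_wpmul2l; last exact: word_sum_length_le1.
    by rewrite lee_fin expR_ge0.
  by rewrite mule1 -!EFinD lee_fin; lra.
- have -> : - (c * (H - eps)) = A + ln 32.
    by rewrite /A cE; field; rewrite gt_eqF.
  rewrite expRD lnK ?posrE // mulrC; lra.
- move=> q q0 Hq; rewrite mulNr mulrN lerN2.
  apply: (le_trans (ler_wpM2l (ltW t0) Hq)).
  rewrite natrM le_eqVlt; apply/orP; left; apply/eqP.
  by field; rewrite gt_eqF.
Qed.

End large_deviations.

(** * Almost everywhere growth of the denominators *)

Section borel_cantelli.
Context {R : realType}.
Notation mu := (@lebesgue_measure R).

Lemma ae_irrational : {ae mu, forall x : R, irrational x}.
Proof.
apply/negligibleP; rewrite setCK.
  by apply: countable_measurable => //; exact: countable_rational.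
apply: countable_lebesgue_measure0; exact: countable_rational.
Qed.

Lemma series_geometric_half_le2 : (\sum_(0 <= k <oo) ((2^-1 : R) ^+ k)%:E <= 2%:E)%E.
Proof.
apply: lime_le.
  by apply: is_cvg_nneseries => k _ _; rewrite lee_fin exprn_ge0 // invr_ge0.
apply: nearW => n; rewrite sumEFin lee_fin.
have -> : \sum_(0 <= k < n) (2^-1 : R) ^+ k = 2 - 2 * 2^-1 ^+ n.
  elim: n => [|n IH]; first by rewrite big_geq // expr0 mulr1 subrr.
  by rewrite big_nat_recr //= IH exprS; field.
by rewrite gerBl mulr_ge0 // exprn_ge0 // invr_ge0.
Qed.

(** Borel-Cantelli: the measures are summable, so the limit superior of the events is a null set. *)
Lemma ae_eventually_not_event (n : nat) (P : nat -> pred nat) :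
  (forall k, (mu (cf_event (k * n) (P k)) <= (2^-1 ^+ k)%:E)%E) ->
  {ae mu, forall x : R, x \in `]0, 1[ -> irrational x ->
    exists K, forall k, (K <= k)%N -> ~~ P k (cf_q x (k * n))}.
Proof.
move=> HP; pose F k : set R := cf_event (k * n) (P k).
have mF k : measurable (F k) by have [] := @word_sum_event R (k * n) (P k).
have F0 : mu (lim_sup_set F) = 0%E.
  apply: lim_sup_set_cvg0 => //.
  apply: (@le_lt_trans _ _ (\sum_(0 <= k <oo) ((2^-1 : R) ^+ k)%:E)%E).
    by apply: lee_nneseries => [k _ _|k _]; [exact: measure_ge0|exact: HP].
  by apply: le_lt_trans series_geometric_half_le2 _; rewrite ltry.
exists (lim_sup_set F); split => //.
  by apply: bigcap_measurable => // k _; apply: bigcup_measurable => j _; exact: mF.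
move=> x /= Hx k _; apply: contrapT => NF; apply: Hx => x01 xirr.
exists k => j kj; apply/negP => Pj; apply: NF.
by exists j.
Qed.

(** For $kn \le m < (k+1)n$, monotonicity places $s_m$ between the values at the two multiples.
    Replacing these by $m$ costs at most $n(H+e)$, hence at most $em$ for large $m$. *)
Lemma nondecreasing_growth_interpolate (s : nat -> R) (n : nat) (H e : R) :
  {homo s : m p / (m <= p)%N >-> m <= p} -> (0 < n)%N -> 0 <= H -> 0 < e ->
  (exists K, forall k, (K <= k)%N ->
     (k * n)%:R * (H - e) <= s (k * n)%N <= (k * n)%:R * (H + e)) ->
  exists M, forall m, (M <= m)%N -> `|s m / m%:R - H| <= 2 * e.
Proof.
move=> smono n0 H0 e0 [K HK].
pose M0 := Num.truncn (n%:R * (H + e) / e).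
exists (maxn (K * n) M0.+1) => m; rewrite geq_max => /andP[Km Mm].
have m0 : 0 < m%:R :> R by rewrite ltr0n; lia.
have mbig : n%:R * (H + e) <= e * m%:R.
  rewrite mulrC [e * _]mulrC -ler_pdivrMr // mulrC.
  by apply: (le_trans (ltW (truncnS_gt _))); rewrite ler_nat.
set k := (m %/ n)%N; set r := (m %% n)%N.
have mE : m = (k * n + r)%N := divn_eq m n.
have rn : (r < n)%N by rewrite ltn_mod.
have Kk : (K <= k)%N by rewrite leq_divRL.
have /andP[lo _] := HK k Kk.
have /andP[_ hi] := HK k.+1 (leqW Kk).
have s1 : s (k * n)%N <= s m by apply: smono; lia.
have s2 : s m <= s (k.+1 * n)%N by apply: smono; lia.
have b1 : (k * n)%:R <= m%:R :> R by rewrite ler_nat; lia.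
have b2 : m%:R <= (k * n)%:R + n%:R :> R by rewrite -natrD ler_nat; lia.
have b3 : (k.+1 * n)%:R = (k * n)%:R + n%:R :> R by rewrite -natrD mulSn addnC.
have n0R : 0 <= n%:R :> R by [].
move: lo hi; rewrite b3.
move: (s m) (s (k * n)%N) (s (k.+1 * n)%N) s1 s2 => sm s1 s2 s1m sm2 lo hi.
move: {mE rn Kk HK Mm Km M0} (k * n)%:R m%:R n%:R b1 b2 b3 mbig m0 n0R lo hi.
move=> kn mm nn b1 b2 b3 mbig m0 n0R lo hi.
have -> : sm / mm - H = (sm - mm * H) / mm by field; rewrite gt_eqF.
rewrite normrM normfV (gtr0_norm m0) ler_pdivrMr // ler_norml.
by apply/andP; split; nra.
Qed.

Lemma cf_q_mono (x : R) : x \in `]0, 1[ -> irrational x ->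
  {homo (fun n => ln (cf_q x n)%:R : R) : m p / (m <= p)%N >-> m <= p}.
Proof.
move=> x01 xirr; apply: homo_leq => // [y z t|n]; first exact: le_trans.
rewrite ler_ln ?posrE ?ltr0n ?cf_q_gt0 // ler_nat.
exact: (@cf_q_prev_le R x n.+1).
Qed.

(** For each tolerance $1/(j+1)$, Borel-Cantelli along the multiples of one fixed [n] and
    interpolation leave a null set of exceptions; the union of these over $j$ is null. *)
Lemma ae_cf_q_growth (H : R) : 0 <= H ->
  (forall e d : R, 0 < e -> 0 < d -> exists N, forall n, (N <= n)%N ->
    (mu (cf_event n (fun q => n%:R * (H + e) < ln q%:R)%R) <= d%:E)%E) ->
  (forall e d : R, 0 < e -> 0 < d -> exists N, forall n, (N <= n)%N ->
    (mu (cf_event n (fun q => ln q%:R < n%:R * (H - e))%R) <= d%:E)%E) ->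
  {ae mu, forall x : R, x \in `]0, 1[ -> irrational x ->
    (fun n => ln (cf_q x n)%:R / n%:R) @ \oo --> H}.
Proof.
move=> H0 up lo.
have aeF : Filter (almost_everywhere mu) by exact: (ae_filter_ringOfSetsType mu).
have Hj (j : nat) : {ae mu, forall x : R, x \in `]0, 1[ -> irrational x ->
    exists M, forall m, (M <= m)%N -> `|ln (cf_q x m)%:R / m%:R - H| <= 2 * j.+1%:R^-1}.
  pose e : R := j.+1%:R^-1.
  have e0 : 0 < e by rewrite invr_gt0.
  have e20 : 0 < e / 2 by rewrite divr_gt0.
  have [N1 HN1] := cf_q_upper_deviation H0 e0 (fun d => up (e / 2) d e20).
  have [N2 HN2] := cf_q_lower_deviation e0 (fun d => lo (e / 2) d e20).
  pose n := (maxn N1 N2).+1.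
  have n1 : (N1 <= n)%N by rewrite /n; lia.
  have n2 : (N2 <= n)%N by rewrite /n; lia.
  have A1 := ae_eventually_not_event (fun k => HN1 n k n1).
  have A2 := ae_eventually_not_event (fun k => HN2 n k n2).
  apply: filterS2 A1 A2 => x A1 A2 x01 xirr.
  have [K1 HK1] := A1 x01 xirr; have [K2 HK2] := A2 x01 xirr.
  apply: (@nondecreasing_growth_interpolate (fun m => ln (cf_q x m)%:R) n) => //.
    exact: cf_q_mono.
  exists (maxn K1 K2) => k; rewrite geq_max => /andP[k1 k2].
  have := HK1 k k1; have := HK2 k k2; rewrite -!ltNge => /ltW -> /ltW ->.
  by [].
apply: filterS (ae_foralln Hj) => x Hx x01 xirr.
apply/cvgrPdist_le => eps eps0.
(* This makes $2/(j+1) \le \varepsilon$. *)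
pose j := Num.truncn (2 / eps).
have [M HM] := Hx j x01 xirr.
exists M => // m /= Mm; rewrite distrC; apply: le_trans (HM m Mm) _.
rewrite ler_pdivrMr // mulrC -ler_pdivrMr //.
exact: ltW (truncnS_gt _).
Qed.

End borel_cantelli.

(** * The Gaussian tails *)

Section gaussian.
Context {R : realType}.
Notation mu := (@lebesgue_measure R).

Definition gaussian_cdf (t : R) : R := (Num.sqrt (2 * pi))^-1 *
  \int[lebesgue_measure]_(w in `]-oo, t]) expR (- (w ^+ 2 / 2)).

(** The standard normal law, seen below as the distribution of the identity, so that the limits of
    [cdf] at $\pm\infty$ apply to the Gaussian integral. *)
Let P01 : probability (measurableTypeR R) R := normal_prob (0 : R) 1.

Let idTR : measurableTypeR R -> R := idfun.

#[local] HB.instance Definition _ :=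
  @isMeasurableFun.Build _ _ _ _ idTR (@measurable_id _ _ setT).

Lemma cdf_normal_prob (t : R) :
  cdf (P := P01) (idTR : {RV P01 >-> R}) t
  = (gaussian_cdf t)%:E.
Proof.
rewrite /cdf /distribution /pushforward /= preimage_id /P01 /= /normal_prob /gaussian_cdf.
have s0 : Num.sqrt (2 * pi) != 0 :> R by rewrite gt_eqF // sqrtr_gt0 mulr_gt0 // pi_gt0.
have fE (w : R) : expR (- (w ^+ 2 / 2)) = Num.sqrt (2 * pi) * normal_pdf 0 1 w.
  rewrite normal_pdfE ?oner_neq0 //= /normal_peak /normal_fun subr0 expr1n mul1r.
  by rewrite -[pi *+ 2]mulr_natl mulrA mulfV // mul1r mulNr.
under eq_Rintegral do rewrite fE.
have int : mu.-integrable `]-oo, t] (EFin \o normal_pdf (0 : R) 1).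
  by apply: integrableS (integrable_normal_pdf 0 1).
rewrite RintegralZl // mulrA mulVf // mul1r /Rintegral fineK //.
exact: integrable_fin_num.
Qed.

Let cvg_gaussian_cdf (F : set_system R) (l : R) : Filter F ->
  cdf (P := P01) (idTR : {RV P01 >-> R}) @ F --> l%:E -> gaussian_cdf @ F --> l.
Proof.
move=> FF Fl; apply: cvg_trans (fine_cvg Fl).
apply: near_eq_cvg; apply: nearW => t; exact: (congr1 fine (cdf_normal_prob t)).
Qed.

Lemma gaussian_cdf_small (d : R) : 0 < d -> exists t, gaussian_cdf t < d.
Proof.
move=> d0.
have : gaussian_cdf x @[x --> -oo] --> (0 : R).
  by apply: cvg_gaussian_cdf; exact: cvg_cdfNy0.
move=> /cvgrPdist_lt /(_ d d0) H; have [t Ht] := filter_ex H.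
by exists t; move: Ht; rewrite sub0r normrN => /(le_lt_trans (ler_norm _)).
Qed.

Lemma gaussian_cdf_large (d : R) : 0 < d -> exists t, 1 - d < gaussian_cdf t.
Proof.
move=> d0.
have : gaussian_cdf x @[x --> +oo] --> (1 : R).
  by apply: cvg_gaussian_cdf; exact: cvg_cdfy1.
move=> /cvgrPdist_lt /(_ d d0) H; have [t Ht] := filter_ex H.
by exists t; move: Ht => /(le_lt_trans (ler_norm _)); lra.
Qed.

End gaussian.

(** * Convergence in probability from the Gaussian estimate *)

Section convergence_in_probability.
Context {R : realType}.
Notation mu := (@lebesgue_measure R).

Lemma cf_event_fineE (n : nat) (P : pred nat) :
  mu (cf_event n P) = (fine (mu (cf_event n P)))%:E.
Proof.
rewrite fineK // ge0_fin_numE ?measure_ge0 //.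
exact: le_lt_trans (cf_event_le1 n P) (ltry 1).
Qed.

Lemma le_cf_event (n : nat) (P Q : pred nat) : (forall q, P q -> Q q) ->
  (mu (cf_event n P) <= mu (cf_event n Q))%E.
Proof.
move=> PQ; have [mP _] := @word_sum_event R n P; have [mQ _] := @word_sum_event R n Q.
by apply: le_measure; rewrite ?inE // => x [x01 xirr Px]; split => //; exact: PQ.
Qed.

Lemma cf_event_disjoint (n : nat) (P Q : pred nat) : (forall q, P q -> Q q -> False) ->
  (mu (cf_event n P) + mu (cf_event n Q) <= 1)%E.
Proof.
move=> PQ; have [mP _] := @word_sum_event R n P; have [mQ _] := @word_sum_event R n Q.
rewrite -measureU //; last first.
  by rewrite -subset0 => x [[_ _ Px] [_ _ Qx]]; exact: PQ Px Qx.
apply: le_trans (cf_event_le1 n predT); apply: le_measure; rewrite ?inE //.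
- exact: measurableU.
- by have [] := @word_sum_event R n predT.
- by move=> x [] [x01 xirr _].
Qed.

Lemma sqrt_nat_ge (c : R) : exists N, forall n, (N <= n)%N -> c <= Num.sqrt n%:R.
Proof.
exists (Num.truncn (c ^+ 2)).+1 => n Nn; apply: (le_trans (ler_norm c)).
rewrite -sqrtr_sqr ler_wsqrtr //; apply: le_trans (ltW (truncnS_gt _)) _.
by rewrite ler_nat.
Qed.

(** $Z_n$ as a function of the denominator instead of $x$, so that its level sets are instances of
    [cf_event]. *)
Definition cf_z (H B : R) (n q : nat) : R := (ln q%:R - H * n%:R) / (B * Num.sqrt n%:R).

Lemma asymptotically_gaussian_cf_event (H B : R) :
  asymptotically_gaussian (fun n x => cf_z H B n (cf_q x n)) ->
  forall t d, 0 < d -> exists N, forall n, (N <= n)%N ->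
    `|fine (mu (cf_event n (fun q => cf_z H B n q < t))) - gaussian_cdf t| <= d.
Proof.
move=> gauss t d d0; have /eqaddOP HO := gauss t.
have [k [N _ HN]] := filter_ex HO.
(* Beyond [M] the error $k/\sqrt n$ is at most $d$; the constant $k$ may depend on $t$. *)
have [M HM] := sqrt_nat_ge (k / d).
exists (maxn N M).+1 => n Hn; have Nn : (N <= n)%N by lia.
have s0 : 0 < Num.sqrt n%:R :> R by rewrite sqrtr_gt0 ltr0n; lia.
(* The closed and the open unit interval have the same irrational points. *)
have -> : cf_event n (fun q => cf_z H B n q < t) =
    [set x : R | [/\ x \in `[0, 1], irrational x & cf_z H B n (cf_q x n) < t]].
  apply/seteqP; split=> x [x01 xirr xt]; split=> //.
    by move: x01; rewrite !in_itv/= => /andP[/ltW -> /ltW ->].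
  move: x01; rewrite !in_itv/= !le_eqVlt => /andP[/orP[/eqP x0|->] /orP[/eqP x1|->]] //;
    by have := irrational_neq_frac 0 1 xirr; have := irrational_neq_frac 1 1 xirr;
       rewrite mul0r divr1 -?x0 -?x1 ?eqxx.
apply: (le_trans (HN n Nn)).
rewrite gtr0_norm ?invr_gt0 // ler_pdivrMr // mulrC -ler_pdivrMr //.
by apply: HM; lia.
Qed.

(** The event says $Z_n < -e\sqrt n/B$. For large $n$ this lies below a fixed level $t$ with
    Gaussian mass less than $d/2$, and the approximation error is at most $d/2$. *)
Lemma gaussian_lower_tail (H B e d : R) : 0 < B -> 0 < e -> 0 < d ->
  asymptotically_gaussian (fun n x => cf_z H B n (cf_q x n)) ->
  exists N, forall n, (N <= n)%N ->
    (mu (cf_event n (fun q => ln q%:R < n%:R * (H - e))%R) <= d%:E)%E.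
Proof.
move=> B0 e0 d0 gauss; have d20 : 0 < d / 2 by rewrite divr_gt0.
have [t Ht] := gaussian_cdf_small d20.
have [N HN] := asymptotically_gaussian_cf_event gauss t d20.
(* Equivalent to $-e\sqrt n/B \le t$. *)
have [M HM] := sqrt_nat_ge (- (t * B / e)).
exists (maxn N M).+1 => n Hn.
have Nn : (N <= n)%N by lia.
have sM : - (t * B / e) <= Num.sqrt n%:R by apply: HM; lia.
have s0 : 0 < Num.sqrt n%:R :> R by rewrite sqrtr_gt0 ltr0n; lia.
have sE : n%:R = Num.sqrt n%:R ^+ 2 :> R by rewrite sqr_sqrtr.
apply: (@le_trans _ _ (mu (cf_event n (fun q => cf_z H B n q < t)))).
  apply: le_cf_event => q Hq; rewrite /cf_z ltr_pdivrMr ?mulr_gt0 //.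
  rewrite -mulNr ler_pdivrMr // in sM.
  move: (Num.sqrt _) s0 sE sM (ler_wpM2l (ltW s0) sM) Hq => s s0 -> _.
  by move: (ln _) => l; nra.
by rewrite cf_event_fineE lee_fin; have := HN n Nn; rewrite ler_norml; lra.
Qed.

(** For large $n$ the event is disjoint from $\{Z_n<t\}$, where $t$ has Gaussian mass above $1-d/2$
    to its left. *)
Lemma gaussian_upper_tail (H B e d : R) : 0 < B -> 0 < e -> 0 < d ->
  asymptotically_gaussian (fun n x => cf_z H B n (cf_q x n)) ->
  exists N, forall n, (N <= n)%N ->
    (mu (cf_event n (fun q => n%:R * (H + e) < ln q%:R)%R) <= d%:E)%E.
Proof.
move=> B0 e0 d0 gauss; have d20 : 0 < d / 2 by rewrite divr_gt0.
have [t Ht] := gaussian_cdf_large d20.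
have [N HN] := asymptotically_gaussian_cf_event gauss t d20.
have [M HM] := sqrt_nat_ge (t * B / e).
exists (maxn N M).+1 => n Hn.
have Nn : (N <= n)%N by lia.
have sM : t * B / e <= Num.sqrt n%:R by apply: HM; lia.
have s0 : 0 < Num.sqrt n%:R :> R by rewrite sqrtr_gt0 ltr0n; lia.
have sE : n%:R = Num.sqrt n%:R ^+ 2 :> R by rewrite sqr_sqrtr.
have := @cf_event_disjoint n (fun q => n%:R * (H + e) < ln q%:R)
  (fun q => cf_z H B n q < t).
rewrite [X in (X + _)%E]cf_event_fineE [X in (_ + X)%E]cf_event_fineE -EFinD.
rewrite (cf_event_fineE _ (fun q => n%:R * (H + e) < ln q%:R)) !lee_fin.
have := HN n Nn; rewrite ler_norml => /andP[HNn _] Hdisj.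
suff /Hdisj : forall q, n%:R * (H + e) < ln q%:R -> cf_z H B n q < t -> False by lra.
move=> q Hq; rewrite /cf_z ltr_pdivrMr ?mulr_gt0 // => Hz.
rewrite ler_pdivrMr // in sM.
move: (Num.sqrt _) s0 sE sM (ler_wpM2l (ltW s0) sM) Hq Hz => s s0 -> _.
by move: (ln _) => l; nra.
Qed.

End convergence_in_probability.

(** * Transfer from the denominators to the Lochs index *)

Section lochs_index_growth.
Context {R : realType}.

(** Logarithm of $q_n \le L_n \le 3q_n$, divided by $n$. *)
Lemma ln_lochs_index_dist (x : R) (n : nat) : (0 < n)%N -> x \in `]0, 1[ -> irrational x ->
  `|ln (lochs_index n x (@CF R) (@Farey R)) / n%:R - ln (cf_q x n)%:R / n%:R|
    <= ln 3 * n%:R^-1.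
Proof.
move=> n0 x01 xirr; have /andP[Lge Lle] := lochs_index_bounds n0 x01 xirr.
have q0 : 0 < (cf_q x n)%:R :> R by rewrite ltr0n cf_q_gt0.
have L0 := lt_le_trans q0 Lge.
have H1 : ln (cf_q x n)%:R <= ln (lochs_index n x (@CF R) (@Farey R)) by rewrite ler_ln.
have H2 : ln (lochs_index n x (@CF R) (@Farey R)) <= ln 3 + ln (cf_q x n)%:R.
  by rewrite -lnM ?posrE // ler_ln ?posrE ?mulr_gt0.
rewrite -mulrBl normrM (gtr0_norm (_ : 0 < n%:R^-1)) ?invr_gt0 ?ltr0n //.
by rewrite ler_pM2r ?invr_gt0 ?ltr0n // ger0_norm; lra.
Qed.

End lochs_index_growth.

Unset Implicit Arguments.

Theorem theorem5p4 (R : realType) (B : R) (hB : 0 < B) :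
  let h : R := pi ^+ 2 / (6 * ln 2) in
  let Z := fun (n : nat) (x : R) =>
    (ln (cf_q x n)%:R - h / 2 * n%:R) / (B * Num.sqrt n%:R) in
  asymptotically_gaussian Z ->
  [/\ forall x : R, x \in `]0, 1[ -> irrational x ->
        (fun n : nat => ln (lochs_index n x (@CF R) (@Farey R)) / n%:R)
        = (fun n : nat => pi ^+ 2 / (12 * ln 2) + B / Num.sqrt n%:R * Z n x)
        +O_\oo (fun n : nat => (n%:R : R)^-1),
      asymptotically_gaussian Z &
      {ae lebesgue_measure, forall x : R, x \in `]0, 1[ ->
        (fun n : nat => ln (lochs_index n x (@CF R) (@Farey R)) / n%:R)
        @ \oo --> (pi ^+ 2 / (12 * ln 2) : R)}].
Proof.
move=> h Z gauss.
have ln2 : 0 < ln 2 :> R by rewrite ln_gt0 // ltr1n.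
have hE : pi ^+ 2 / (12 * ln 2) = h / 2 by rewrite /h; field; rewrite gt_eqF.
have h0 : 0 <= h / 2 by rewrite -hE divr_ge0 ?exprn_ge0 ?pi_ge0 // mulr_ge0 // ltW.
have ln3 : 0 < ln 3 :> R by rewrite ln_gt0 // ltr1n.
rewrite hE; split=> //.
- move=> x x01 xirr; apply/eqaddOP/bigO_exP; exists (ln 3) => //.
  exists 1%N => // n /= n1; rewrite [`|n%:R^-1|]ger0_norm ?invr_ge0 //.
  apply: le_trans (ln_lochs_index_dist n1 x01 xirr).
  (* By the definition of $Z_n$, the main term $h/2 + BZ_n/\sqrt n$ is exactly $\log q_n/n$, so $\ln
     3$ serves as the constant of the error term. *)
  rewrite le_eqVlt; apply/orP; left; apply/eqP; congr `|_|; congr (_ - _).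
  have s0 : 0 < Num.sqrt n%:R :> R by rewrite sqrtr_gt0 ltr0n.
  have sE : n%:R = Num.sqrt n%:R ^+ 2 :> R by rewrite sqr_sqrtr.
  rewrite /Z; move: (Num.sqrt _) s0 sE => s s0 ->.
  by field; rewrite !gt_eqF.
- have lim_q : {ae lebesgue_measure, forall x : R, x \in `]0, 1[ -> irrational x ->
      (fun n => ln (cf_q x n)%:R / n%:R) @ \oo --> h / 2}.
    apply: ae_cf_q_growth => // e d e0 d0; first exact: gaussian_upper_tail gauss.
    exact: gaussian_lower_tail gauss.
  have aeF : Filter (almost_everywhere (@lebesgue_measure R)).
    exact: (ae_filter_ringOfSetsType (@lebesgue_measure R)).
  (* The conclusion ranges over all points of $(0,1)$; the rational ones go into the exceptional
     null set. *)
  apply: filterS2 lim_q (@ae_irrational R) => x lim_x xirr x01.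
  apply/cvgrPdist_le => e e0.
  have e20 : 0 < e / 2 by rewrite divr_gt0.
  have [N _ HN] := (cvgrPdist_le _ _).1 (lim_x x01 xirr) (e / 2) e20.
  (* From [M] on, the distance $\ln 3/n$ between the two logarithmic rates is at most $e/2$. *)
  pose M := (Num.truncn (ln 3 / (e / 2))).+1.
  exists (maxn N M) => // n; rewrite /= geq_max => /andP[/HN Hn Mn].
  have n0 : (0 < n)%N by apply: leq_trans Mn.
  have n0R : 0 < n%:R :> R by rewrite ltr0n.
  have Hd := ln_lochs_index_dist n0 x01 xirr.
  have He : ln 3 * n%:R^-1 <= e / 2.
    rewrite ler_pdivrMr // mulrC -ler_pdivrMr //.
    by apply: (le_trans (ltW (truncnS_gt _))); rewrite ler_nat.
  move: Hn Hd; rewrite !ler_norml => /andP[? ?] /andP[? ?].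
  by apply/andP; split; lra.
Qed.
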